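(* Let $a<b$, $n,m\in\mathbb N$, $\Omega=\prod_{i=1}^n[a_i,b_i]$, $P=[a,b]\times\Omega$, $\alpha=(\alpha_1,\ldots,\alpha_m)$ and $\beta_i=(\beta_{i,1},\ldots,\beta_{i,m})$ ($i=1,\ldots,n$) with all $\alpha_j,\beta_{i,j}\in(0,1)$, $z_a\in\mathbb R$, and $g:\partial P\to\mathbb R^m$ given. Call $u=(u_1,\ldots,u_m)$ admissible if $u_j\in C^1(P,\mathbb R)$, ${^C_aD^{\alpha_j}_t}u_j,{^C_{a_i}D^{\beta_{i,j}}_{x_i}}u_j\in C^1(P,\mathbb R)$ for all $i,j$, and $u=g$ on $\partial P$. Let $L:P\times\mathbb R^{m(n+2)+1}\to\mathbb R$ be of class $C^1$, and for admissible $u$ let $z[u;\cdot]$ be the solution of $$\frac{dz}{dt}=\int_\Omega L\big(t,x,u(t,x),{^C_aD^{\alpha}_t}u(t,x),{^C_{a_1}D^{\beta_1}_{x_1}}u(t,x),\ldots,{^C_{a_n}D^{\beta_n}_{x_n}}u(t,x),z(t)\big)\,d^nx,\quad t\in[a,b],\qquad z(a)=z_a.$$ Write $[u,z](t,x)$ for the argument tuple of $L$ above and $\lambda(t):=\exp\left(-\int_a^t\int_\Omega\frac{\partial L}{\partial z}[u,z](\tau,x)\,d^nx\,d\tau\right)$, and assume that for all $i\in\{1,\ldots,n\}$, $j\in\{1,\ldots,m\}$ the functions ${_tD^{\alpha_j}_b}\left(\lambda(t)\frac{\partial L}{\partial {^C_aD^{\alpha_j}_t}u_j}[u,z](t,x)\right)$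 and ${_{x_i}D^{\beta_{i,j}}_{b_i}}\left(\lambda(t)\frac{\partial L}{\partial {^C_{a_i}D^{\beta_{i,j}}_{x_i}}u_j}[u,z](t,x)\right)$ exist and are continuous on $P$. If $u$ is admissible and $z[u;b]$ attains an extremum (so $\frac{d}{d\epsilon}z[u+\epsilon\eta;b]|_{\epsilon=0}=0$ for all $\eta\in C^1(P,\mathbb R^m)$ with $\eta=0$ on $\partial P$ and ${^C_aD^{\alpha_j}_t}\eta_j,{^C_{a_i}D^{\beta_{i,j}}_{x_i}}\eta_j\in C^1(P,\mathbb R)$), then for $j=1,\ldots,m$, on $P$, $$\lambda(t)\frac{\partial L}{\partial u_j}[u,z](t,x)+{_tD^{\alpha_j}_b}\left(\lambda(t)\frac{\partial L}{\partial {^C_aD^{\alpha_j}_t}u_j}[u,z](t,x)\right)+\sum_{i=1}^n{_{x_i}D^{\beta_{i,j}}_{b_i}}\left(\lambda(t)\frac{\partial L}{\partial {^C_{a_i}D^{\beta_{i,j}}_{x_i}}u_j}[u,z](t,x)\right)=0.$$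
   Context: Notation: $x=(x_1,\ldots,x_n)\in\Omega$, $d^nx=dx_1\cdots dx_n$, ${^C_aD^\alpha_t}u=({^C_aD^{\alpha_1}_t}u_1,\ldots,{^C_aD^{\alpha_m}_t}u_m)$, ${^C_{a_i}D^{\beta_i}_{x_i}}u=({^C_{a_i}D^{\beta_{i,1}}_{x_i}}u_1,\ldots,{^C_{a_i}D^{\beta_{i,m}}_{x_i}}u_m)$. For order $\gamma\in(0,1)$, the partial left Caputo derivative in the variable $s\in[c,d]$ (with the other variables frozen) is ${^C_cD^\gamma_s}f=\frac{1}{\Gamma(1-\gamma)}\int_c^s(s-\sigma)^{-\gamma}\partial_\sigma f(\ldots,\sigma,\ldots)\,d\sigma$, and the partial right Riemann–Liouville derivative is ${_sD^\gamma_d}f=\frac{-1}{\Gamma(1-\gamma)}\frac{\partial}{\partial s}\int_s^d(\sigma-s)^{-\gamma}f(\ldots,\sigma,\ldots)\,d\sigma$. Partial derivatives of $L$ are with respect to the indicated components of its arguments. The solution $z$ is assumed to exist and depend differentiably on $\epsilon$ when $u$ is replaced by $u+\epsilon\eta$, with the same initial value $z_a$. *)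

(* Defs.v *)
From HB Require Import structures.
From mathcomp Require Import all_boot all_order all_algebra.
From mathcomp Require Import all_classical all_reals all_analysis.
Set Implicit Arguments. Unset Strict Implicit. Unset Printing Implicit Defensive.
Import Order.TTheory GRing.Theory Num.Theory.
Import numFieldNormedType.Exports.
Local Open Scope classical_set_scope.
Local Open Scope ring_scope.

Section Defs.
Variable R : realType.

Definition Lint (D : set R) (f : R -> R) : R := Rintegral (@lebesgue_measure R) D f.

Definition cc (c d : R) : set R := [set s | c <= s <= d].

Definition Gamma (s : R) : R :=
  Lint [set t | 0 < t] (fun t => t `^ (s - 1) * expR (- t)).

Definition deriv_within (S : set R) (f : R -> R) (t d : R) : Prop :=
  forall e : R, 0 < e -> exists del : R, 0 < del /\
    forall h : R, h != 0 -> `|h| < del -> S (t + h) ->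
      `|(f (t + h) - f t) / h - d| < e.

Definition upd (I : eqType) (p : I -> R) (k : I) (s : R) : I -> R :=
  fun k' => if k' == k then s else p k'.

Definition pderiv_within (I : eqType) (S : set (I -> R)) (F : (I -> R) -> R)
    (p : I -> R) (k : I) (d : R) : Prop :=
  deriv_within [set s | S (upd p k s)] (fun s => F (upd p k s)) (p k) d.

Definition pd (I : eqType) (F : (I -> R) -> R) (k : I) (p : I -> R) : R :=
  derive1 (fun s => F (upd p k s)) (p k).

Definition cont_within (I : eqType) (S : set (I -> R)) (F : (I -> R) -> R)
    (p : I -> R) : Prop :=
  forall e : R, 0 < e -> exists del : R, 0 < del /\
    forall q, S q -> (forall k, `|q k - p k| < del) -> `|F q - F p| < e.

Definition C1on (I : eqType) (S : set (I -> R)) (F : (I -> R) -> R) : Prop :=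
  (forall p, S p -> cont_within S F p) /\
  forall k : I, exists Dk : (I -> R) -> R,
    (forall p, S p -> pderiv_within S F p k (Dk p)) /\
    (forall p, S p -> cont_within S Dk p).

Definition caputo (I : eqType) (c gam : R) (F : (I -> R) -> R) (k : I)
    (p : I -> R) : R :=
  (Gamma (1 - gam))^-1 *
  Lint (cc c (p k)) (fun sig => (p k - sig) `^ (- gam) * pd F k (upd p k sig)).

(* v is the value at p of the partial right Riemann-Liouville derivative of
   order gam in coordinate k with upper bound d, the derivative in s being
   taken within S:
   v = -1/Gamma(1-gam) * d/ds int_s^d (sig - s)^(-gam) F(.., sig, ..) dsig *)
Definition is_RLright (I : eqType) (S : set (I -> R)) (d gam : R)
    (F : (I -> R) -> R) (k : I) (p : I -> R) (v : R) : Prop :=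
  pderiv_within S
    (fun q => Lint (cc (q k) d)
                (fun sig => (sig - q k) `^ (- gam) * F (upd q k sig)))
    p k (- Gamma (1 - gam) * v).

Variables n m : nat.

(* coordinates of a point of P = [a,b] x Omega : None is t, Some i is x_i *)
Definition pcoord := option 'I_n.

Definition lo (a : R) (aa : 'I_n -> R) (k : pcoord) : R :=
  if k is Some i then aa i else a.
Definition hi (b : R) (bb : 'I_n -> R) (k : pcoord) : R :=
  if k is Some i then bb i else b.

Definition Pset (a b : R) (aa bb : 'I_n -> R) : set (pcoord -> R) :=
  [set p | forall k, lo a aa k <= p k <= hi b bb k].

Definition bdP (a b : R) (aa bb : 'I_n -> R) : set (pcoord -> R) :=
  [set p | Pset a b aa bb p /\
           exists k, p k = lo a aa k \/ p k = hi b bb k].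

Fixpoint iint (aa bb : 'I_n -> R) (s : seq 'I_n) (G : (pcoord -> R) -> R)
    (p : pcoord -> R) : R :=
  match s with
  | [::] => G p
  | i :: s' => Lint (cc (aa i) (bb i))
                    (fun y => iint aa bb s' G (upd p (Some i) y))
  end.

Definition intOmega (aa bb : 'I_n -> R) (G : (pcoord -> R) -> R) (t : R) : R :=
  iint aa bb (enum 'I_n) G (fun k => if k is None then t else 0).

(* index set of the m(n+2)+1 real arguments of L after (t,x):
   u_j | C_aD^{alpha_j}_t u_j | C_{a_i}D^{beta_ij}_{x_i} u_j | z *)
Definition widx := ('I_m + 'I_m + ('I_n * 'I_m) + unit)%type.
Definition Wu (j : 'I_m) : widx := inl (inl (inl j)).
Definition Wdt (j : 'I_m) : widx := inl (inl (inr j)).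
Definition Wdx (i : 'I_n) (j : 'I_m) : widx := inl (inr (i, j)).
Definition Wz : widx := inr tt.

Definition args (a : R) (aa : 'I_n -> R) (alpha : 'I_m -> R)
    (beta : 'I_n -> 'I_m -> R) (u : 'I_m -> (pcoord -> R) -> R)
    (z : R -> R) (p : pcoord -> R) : widx -> R :=
  fun w => match w with
  | inl (inl (inl j)) => u j p
  | inl (inl (inr j)) => caputo a (alpha j) (u j) None p
  | inl (inr (i, j)) => caputo (aa i) (beta i j) (u j) (Some i) p
  | inr _ => z (p None)
  end.

Definition regular (a b : R) (aa bb : 'I_n -> R) (alpha : 'I_m -> R)
    (beta : 'I_n -> 'I_m -> R) (v : 'I_m -> (pcoord -> R) -> R) : Prop :=
  forall j, C1on (Pset a b aa bb) (v j) /\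
    C1on (Pset a b aa bb) (caputo a (alpha j) (v j) None) /\
    forall i, C1on (Pset a b aa bb) (caputo (aa i) (beta i j) (v j) (Some i)).

Definition admissible a b aa bb alpha beta
    (g : (pcoord -> R) -> 'I_m -> R) (v : 'I_m -> (pcoord -> R) -> R) : Prop :=
  regular a b aa bb alpha beta v /\
  forall j p, bdP a b aa bb p -> v j p = g p j.

Definition admissible_variation a b aa bb alpha beta
    (eta : 'I_m -> (pcoord -> R) -> R) : Prop :=
  regular a b aa bb alpha beta eta /\
  forall j p, bdP a b aa bb p -> eta j p = 0.

End Defs.

(* Main.v *)
(** Along u + e eta the difference y of the states satisfies
    y' = e A + B y + o(|e| + |y|) uniformly on [a, b], where A is the integral
    over Omega of the derivative of L in the direction of eta and B that of
    dL/dz, because the partial derivatives of L are uniformly continuous on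
    compact sets.  A Gronwall estimate gives y = O(e), so that
    lam(b) y(b) = e int lam A + o(e), and extremality means int lam A = 0.
    For eta take products of quadratic B-splines in the coordinates: their
    Caputo derivatives are explicit combinations of truncated powers of
    exponent 2 - gamma > 1, hence C^1.  Fubini on a triangle and ordinary
    integration by parts move the Caputo derivative from eta to a
    Riemann-Liouville derivative of the other factor.  B-splines are
    nonnegative with arbitrarily small support, so the fundamental lemma holds
    for them in one variable, and then on P one coordinate at a time. *)

Require Import Defs.
From HB Require Import structures.
From mathcomp Require Import all_boot all_order all_algebra.
From mathcomp Require Import all_classical all_reals all_analysis.
From mathcomp Require Import measurable_realfun ring lra.
Import Order.TTheory GRing.Theory Num.Theory.
Import numFieldNormedType.Exports.
Local Open Scope classical_set_scope.
Local Open Scope ring_scope.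
Set Implicit Arguments.
Unset Strict Implicit.
Unset Printing Implicit Defensive.

(** * Continuity on boxes *)

(** Degree two is the lowest that works for the splines. A Caputo derivative of order gamma
    differentiates once and then integrates against a kernel of degree -gamma, so it turns (s -
    c)_+^2 into a multiple of (s - c)_+^(2 - gamma), which is C^1 since gamma < 1; piecewise linear
    functions would leave only the exponent 1 - gamma < 1. The unbounded kernel is confined to
    single lines: integrals over Omega are iterated integrals of continuous functions, exchanged by
    uniform continuity, and measure-theoretic Fubini enters once, on a triangle in the plane. Two
    notions of derivative have to be reconciled. The data are differentiable within P, while
    [caputo] is built on the two-sided [pd], whose value at a face depends on the function outside
    P. They agree at points interior in the coordinate concerned, and the ends are null for the
    integral. Products of splines vanish at both ends of each coordinate, hence on the whole
    boundary; this makes them admissible and removes all boundary terms. Time is one more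
    coordinate: lam depends on t alone, so int lam A is an integral over P. *)

Section ContinuityOnBoxes.
Variables (R : realType) (I : finType).
Implicit Types (S : set (I -> R)) (F G : (I -> R) -> R) (p q : I -> R).

(** The filter along which [cont_within] is convergence, so that the limit theorems for sums and
    products apply to it directly. *)
Definition within_nbhs S p : set_system (I -> R) :=
  filter_from [set e : R | 0 < e]
    (fun e => [set q | S q /\ forall k, `|q k - p k| < e]).

Global Instance within_nbhs_filter S p : Filter (within_nbhs S p).
Proof.
apply: filter_from_filter; first by exists 1 => /=.
move=> d e /= d0 e0; exists (Num.min d e) => /=; first by rewrite lt_min d0.
move=> q [Sq h]; split; split => // k; have := h k; rewrite lt_min => /andP[] //.
Qed.

Lemma cont_withinP S F p :
  cont_within S F p <-> F @ within_nbhs S p --> F p.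
Proof.
split=> [h|/cvgrPdist_lt h e e0].
  apply/cvgrPdist_lt => e e0; have [d [d0 hd]] := h e e0.
  by exists d => //= q [Sq hq]; rewrite distrC; exact: hd.
have [d d0 hd] := h e e0; exists d; split => // q Sq hq.
by rewrite distrC; apply: hd.
Qed.

Definition cont_on S F := forall p, S p -> cont_within S F p.

Lemma cont_on_cst S (c : R) : cont_on S (fun=> c).
Proof. by move=> p Sp; apply/cont_withinP; exact: cvg_cst. Qed.

Lemma cont_onD S F G : cont_on S F -> cont_on S G ->
  cont_on S (fun p => F p + G p).
Proof.
move=> hF hG p Sp; apply/cont_withinP; apply: cvgD.
  exact/cont_withinP/hF.
exact/cont_withinP/hG.
Qed.

Lemma cont_onM S F G : cont_on S F -> cont_on S G ->
  cont_on S (fun p => F p * G p).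
Proof.
move=> hF hG p Sp; apply/cont_withinP; apply: cvgM.
  exact/cont_withinP/hF.
exact/cont_withinP/hG.
Qed.

Lemma cont_on_sum S (J : Type) (r : seq J) (P : pred J) (F : J -> (I -> R) -> R) :
  (forall j, P j -> cont_on S (F j)) ->
  cont_on S (fun p => \sum_(j <- r | P j) F j p).
Proof.
move=> h; elim: r => [|j r IH].
  rewrite (_ : (fun _ => _) = fun=> 0); first exact: cont_on_cst.
  by apply/funext => p; rewrite big_nil.
rewrite (_ : (fun _ => _) = fun p => (if P j then F j p else 0) +
    \sum_(j <- r | P j) F j p).
  apply: cont_onD => //; case: (boolP (P j)) => [/h//|_]; exact: cont_on_cst.
by apply/funext => p; rewrite big_cons; case: (P j) => //; rewrite add0r.
Qed.

Lemma cont_on_prod S (J : Type) (r : seq J) (P : pred J) (F : J -> (I -> R) -> R) :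
  (forall j, P j -> cont_on S (F j)) ->
  cont_on S (fun p => \prod_(j <- r | P j) F j p).
Proof.
move=> h; elim: r => [|j r IH].
  rewrite (_ : (fun _ => _) = fun=> 1); first exact: cont_on_cst.
  by apply/funext => p; rewrite big_nil.
rewrite (_ : (fun _ => _) = fun p => (if P j then F j p else 1) *
    \prod_(j <- r | P j) F j p).
  apply: cont_onM => //; case: (boolP (P j)) => [/h//|_]; exact: cont_on_cst.
by apply/funext => p; rewrite big_cons; case: (P j) => //; rewrite mul1r.
Qed.

Lemma cont_on_eq S F G : (forall p, S p -> F p = G p) ->
  cont_on S F -> cont_on S G.
Proof.
move=> FG hF p Sp e e0; have [d [d0 hd]] := hF p Sp e e0.
by exists d; split => // q Sq hq; rewrite -!FG//; exact: hd.
Qed.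

End ContinuityOnBoxes.
Arguments cont_on {R I}.

Section Boxes.
Variables (R : realType) (I : finType).
Implicit Types (F G : (I -> R) -> R) (p q : I -> R).

Definition box (l h : I -> R) : set (I -> R) :=
  [set p | forall k, l k <= p k <= h k].

Lemma box_compact (l h : I -> R) :
  compact (box l h : set (prod_topology (fun _ : I => R))).
Proof.
have := @tychonoff I (fun _ => R) (fun k => `[l k, h k]%classic).
move/(_ (fun k => @segment_compact _ _ _)).
by congr compact; apply/seteqP; split => p hp k; have := hp k; rewrite /= in_itv.
Qed.

(** Here finiteness of [I] matters: the set is a finite intersection of preimages of balls under the
    projections, so the sup-distance of [cont_within] fits the product topology of [box_compact]. *)
Lemma prod_ball_nbhs (p : prod_topology (fun _ : I => R)) (e : R) : 0 < e ->
  nbhs p [set q : prod_topology (fun _ : I => R) | forall k, `|q k - p k| < e].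
Proof.
move=> e0.
have h k : nbhs p (proj k @^-1` ball (p k) e).
  by apply: (@proj_continuous I (fun _ => R) k p); exact: nbhsx_ballx.
have FF : Filter (nbhs p) := nbhs_filter p.
apply: (@filterS _ _ FF (fun q => forall k, (proj k @^-1` ball (p k) e) q)).
  by move=> q hq k; have := hq k; rewrite /ball /= distrC.
exact: (@filter_forall _ _ _ _ FF h).
Qed.

(** Heine-Cantor, by the near-covering form of compactness: a statement about p and d that holds for
    p near each point and all small d holds for one d on the whole box. This uniformity is what
    controls integrals of differences. *)
Lemma cont_on_box_unif (l h : I -> R) F : cont_on (box l h) F ->
  forall e : R, 0 < e -> exists d : R, 0 < d /\
    forall p q, box l h p -> box l h q -> (forall k, `|q k - p k| < d) ->
    `|F q - F p| < e.
Proof.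
move=> cF e e0.
have /compact_near_coveringP := @box_compact l h.
move=> /(_ R 0^'+ (fun d p => box l h p -> forall q, box l h q ->
  (forall k, `|q k - p k| < d) -> `|F q - F p| < e)).
case=> [x Kx|d /= d0 hd].
  have [d [d0 hd]] := cF x Kx (e/2) (divr_gt0 e0 (ltr0Sn _ 1)).
  exists ([set q | forall k, `|q k - x k| < d/2], [set t | t < d/2]).
    split => /=; first by apply: prod_ball_nbhs; exact: divr_gt0.
    by apply: nbhs_right_lt; exact: divr_gt0.
  move=> [p t] /= [hp ht] Kp q Kq hq.
  have h1 : `|F p - F x| < e/2.
    by apply: hd => // k; apply: lt_trans (hp k) _; lra.
  have h2 : `|F q - F x| < e/2.
    apply: hd => // k.
    rewrite (_ : q k - x k = (q k - p k) + (p k - x k)); last by ring.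
    by apply: le_lt_trans (ler_normD _ _) _; have := hq k; have := hp k; lra.
  rewrite (_ : F q - F p = (F q - F x) - (F p - F x)); last by ring.
  by apply: le_lt_trans (ler_normB _ _) _; lra.
exists (d/2); split; first exact: divr_gt0.
move=> p q Kp Kq hq; apply: (hd (d/2)) => //=.
  by rewrite sub0r normrN gtr0_norm ?divr_gt0// ltr_pdivrMr// ltr_pMr// ltr1n.
exact: divr_gt0.
Qed.

Lemma cont_on_box_bounded (l h : I -> R) F : cont_on (box l h) F ->
  exists M : R, 0 < M /\ forall p, box l h p -> `|F p| <= M.
Proof.
move=> cF.
have /compact_near_coveringP := @box_compact l h.
move=> /(_ R +oo (fun M p => box l h p -> `|F p| <= M)).
case=> [x Kx|M [_ hM]].
  have [d [d0 hd]] := cF x Kx 1 ltr01.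
  exists ([set q | forall k, `|q k - x k| < d], [set t | `|F x| + 1 < t]).
    split => /=; first exact: prod_ball_nbhs.
    by apply: nbhs_pinfty_gt; exact: num_real.
  move=> [p t] /= [hp ht] Kp; apply: le_trans (ltW ht).
  rewrite (_ : F p = F x + (F p - F x)); last by ring.
  by apply: le_trans (ler_normD _ _) _; rewrite lerD2l ltW// hd.
exists (Num.max M 0 + 1); split; first by rewrite ltr_wpDl// le_max lexx orbT.
move=> p Kp; apply: hM => //.
by apply: le_lt_trans (_ : M <= Num.max M 0) _; rewrite ?le_max ?lexx// ltrDl.
Qed.

End Boxes.

(** * Calculus on an interval *)

Section Interval.
Variable R : realType.
Implicit Types (c d t M : R) (f g F G : R -> R).

Lemma ccE c d : cc c d = `[c, d]%classic.
Proof. by apply/seteqP; split => x; rewrite /cc /= in_itv. Qed.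

Lemma within_ccP c d f : {within `[c, d], continuous f} <->
  forall s, c <= s <= d -> forall e : R, 0 < e -> exists del : R, 0 < del /\
    forall t, c <= t <= d -> `|t - s| < del -> `|f t - f s| < e.
Proof.
split.
  move/subspace_continuousP => h s /= sc e e0.
  have /h/cvgrPdist_lt/(_ e e0) : `[c, d]%classic s by rewrite /= in_itv.
  rewrite /within /= => /nbhs_ballP[del /= del0 hd]; exists del; split => // t tc ts.
  by rewrite distrC; apply: (hd t); rewrite /ball /= ?in_itv// distrC.
move=> h; apply/subspace_continuousP => s; rewrite /= in_itv /= => sc.
apply/cvgrPdist_lt => e e0; have [del [del0 hd]] := h s sc e e0.
apply/nbhs_ballP; exists del => //= t ts; rewrite in_itv /= => tc.
by rewrite distrC; apply: hd => //; rewrite distrC.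
Qed.

Lemma within_cc_eq c d f g : (forall s, c <= s <= d -> f s = g s) ->
  {within `[c, d], continuous f} -> {within `[c, d], continuous g}.
Proof.
move=> fg /within_ccP h; apply/within_ccP => s sc e e0.
have [del [del0 hd]] := h s sc e e0; exists del; split => // t tc ts.
by rewrite -!fg//; exact: hd.
Qed.

Lemma within_ccS c d c' d' f : c <= c' -> d' <= d ->
  {within `[c, d], continuous f} -> {within `[c', d'], continuous f}.
Proof.
move=> cc' dd'; apply: continuous_subspaceW => x /=; rewrite !in_itv /=.
by move=> /andP[h1 h2]; rewrite (le_trans cc' h1) (le_trans h2 dd').
Qed.

Lemma within_ccM c d f g : {within `[c, d], continuous f} ->
  {within `[c, d], continuous g} -> {within `[c, d], continuous (fun s => f s * g s)}.
Proof. by move=> cf cg x; apply: continuousM; [exact: cf|exact: cg]. Qed.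

Lemma within_ccD c d f g : {within `[c, d], continuous f} ->
  {within `[c, d], continuous g} -> {within `[c, d], continuous (fun s => f s + g s)}.
Proof. by move=> cf cg x; apply: continuousD; [exact: cf|exact: cg]. Qed.

Lemma within_ccN c d f : {within `[c, d], continuous f} ->
  {within `[c, d], continuous (fun s => - f s)}.
Proof. by move=> cf x; apply: continuousN; exact: cf. Qed.

Lemma within_cc_cst c d (v : R) : {within `[c, d], continuous (fun=> v)}.
Proof. by move=> x; exact: cst_continuous. Qed.

Lemma within_cc_cont c d f : continuous f -> {within `[c, d], continuous f}.
Proof. exact: continuous_subspaceT. Qed.

Lemma within_cc_bounded c d f : {within `[c, d], continuous f} ->
  exists M, 0 < M /\ forall s, c <= s <= d -> `|f s| <= M.
Proof.
move=> cf.
have := continuous_compact cf (@segment_compact _ c d).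
move/compact_bounded => [M [_ hM]].
exists (Num.max M 0 + 1); split; first by rewrite ltr_wpDl// le_max lexx orbT.
move=> s sc; apply: (hM (Num.max M 0 + 1)).
  by apply: le_lt_trans (_ : M <= Num.max M 0) _; rewrite ?le_max ?lexx// ltrDl.
by exists s; rewrite //= in_itv.
Qed.

Lemma cc_measurable c d : measurable (cc c d : set R).
Proof. by rewrite ccE. Qed.

Lemma within_cc_integrable c d f : {within `[c, d], continuous f} ->
  (@lebesgue_measure R).-integrable (cc c d) (EFin \o f).
Proof.
move=> cf; rewrite ccE; apply: continuous_compact_integrable => //.
exact: segment_compact.
Qed.

Lemma Lint_eq (D : set R) f g : (forall s, D s -> f s = g s) ->
  Lint D f = Lint D g.
Proof. by move=> h; apply: eq_Rintegral => s /set_mem; exact: h. Qed.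

Lemma Lint_cc1 c f : Lint (cc c c) f = 0.
Proof. by rewrite ccE set_itv1 /Lint Rintegral_set1. Qed.

Lemma LintD c d f g : {within `[c, d], continuous f} ->
  {within `[c, d], continuous g} ->
  Lint (cc c d) (fun s => f s + g s) = Lint (cc c d) f + Lint (cc c d) g.
Proof.
move=> cf cg; rewrite /Lint RintegralD//; first exact: cc_measurable.
  exact: within_cc_integrable.
exact: within_cc_integrable.
Qed.

Lemma LintZ c d (v : R) f : {within `[c, d], continuous f} ->
  Lint (cc c d) (fun s => v * f s) = v * Lint (cc c d) f.
Proof.
move=> cf; rewrite /Lint RintegralZl//; first exact: cc_measurable.
exact: within_cc_integrable.
Qed.

Lemma Lint_cst c d (v : R) : c <= d -> Lint (cc c d) (fun=> v) = v * (d - c).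
Proof.
move=> cd; rewrite /Lint ccE Rintegral_cst//=.
by rewrite lebesgue_measure_itv /= lte_fin; case: ltP => //= h;
  rewrite (@le_anti _ _ c d) ?cd// subrr.
Qed.

Lemma Lint_le c d f g : {within `[c, d], continuous f} ->
  {within `[c, d], continuous g} -> (forall s, c <= s <= d -> f s <= g s) ->
  Lint (cc c d) f <= Lint (cc c d) g.
Proof.
move=> cf cg fg; apply: le_Rintegral => //; first exact: cc_measurable.
  exact: within_cc_integrable.
exact: within_cc_integrable.
Qed.

Lemma Lint_bound c d f M : c <= d -> {within `[c, d], continuous f} ->
  (forall s, c <= s <= d -> `|f s| <= M) -> `|Lint (cc c d) f| <= M * (d - c).
Proof.
move=> cd cf h; rewrite -(Lint_cst M cd) ler_norml; apply/andP; split.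
  rewrite (_ : - Lint _ _ = Lint (cc c d) (fun=> - M)); last first.
    by rewrite !Lint_cst// mulNr.
  apply: Lint_le => //; first exact: within_cc_cst.
  by move=> s /h; rewrite ler_norml => /andP[].
apply: Lint_le => //; first exact: within_cc_cst.
by move=> s /h; rewrite ler_norml => /andP[].
Qed.

(** Continuity up to the ends but a derivative only inside: this is what the mean value theorem
    needs, and it admits (s - x)^(1 - g), whose derivative is unbounded at an end. *)
Definition primitive_on c d F f :=
  {within `[c, d], continuous F} /\
  forall t, c < t < d -> is_derive t (1 : R) F (f t).

Lemma deriv_within_is_derive (S : set R) f t (v : R) :
  (exists e : R, 0 < e /\ forall s, `|s - t| < e -> S s) ->
  deriv_within S f t v -> is_derive t (1 : R) f v.
Proof.
move=> [e0 [e00 hS]] h.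
have hc : h^-1 *: (f (h *: (1 : R) + t) - f t) @[h --> 0^'] --> v.
  apply/cvgrPdist_lt => e e_gt0; have [del [del0 hd]] := h e e_gt0.
  apply/nbhs_ballP; exists (Num.min del e0); first by rewrite /= lt_min del0.
  move=> k; rewrite /ball /= sub0r normrN lt_min => /andP[k1 k2] k0.
  rewrite [k%:A]mulr1 distrC [_ *: _]mulrC (addrC k).
  by apply: hd => //; apply: hS; rewrite addrC addKr.
apply: DeriveDef; first by apply/cvg_ex; exists v.
exact/cvg_lim.
Qed.

Lemma is_derive_deriv_within (S : set R) f t (v : R) :
  is_derive t (1 : R) f v -> deriv_within S f t v.
Proof.
move=> [/cvg_ex[/= l hl] fE] e e0.
have lE : l = v by rewrite -fE; apply/esym/cvg_lim.
move/cvgrPdist_lt: hl => /(_ e e0) /nbhs_ballP[del /= del0 hd].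
exists del; split => // k k0 kd _.
have := hd k; rewrite /ball /= sub0r normrN => /(_ kd k0).
by rewrite [k%:A]mulr1 distrC lE [_ *: _]mulrC (addrC k).
Qed.

Lemma deriv_within_cont (S : set R) f t (v : R) : deriv_within S f t v ->
  forall e : R, 0 < e -> exists del : R, 0 < del /\
    forall s, S s -> `|s - t| < del -> `|f s - f t| < e.
Proof.
move=> h e e0; have [del [del0 hd]] := h 1 ltr01.
have v1 : 0 < `|v| + 1 by rewrite ltr_wpDl.
exists (Num.min del (e / (`|v| + 1))); split.
  by rewrite lt_min del0 divr_gt0.
move=> s Ss; rewrite lt_min => /andP[s1 s2].
have [->|st] := eqVneq s t; first by rewrite subrr normr0.
have st0 : s - t != 0 by rewrite subr_eq0.
have := hd (s - t) st0 s1; rewrite addrC subrK => /(_ Ss) h1.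
have -> : f s - f t = (s - t) * ((f s - f t) / (s - t) - v + v).
  by rewrite subrK mulrC divfK.
rewrite normrM (@le_lt_trans _ _ (`|s - t| * (`|v| + 1)))//.
  apply: ler_wpM2l => //; apply: le_trans (ler_normD _ _) _.
  by rewrite addrC lerD2l ltW.
by rewrite -ltr_pdivlMr.
Qed.

Lemma deriv_within_primitive c d F f :
  (forall t, c <= t <= d -> deriv_within (cc c d) F t (f t)) ->
  primitive_on c d F f.
Proof.
move=> h; split.
  apply/within_ccP => s sc e e0.
  by have [del [del0 hd]] := deriv_within_cont (h s sc) e0; exists del.
move=> t /andP[ct td]; apply: deriv_within_is_derive (h t _); last by rewrite !ltW.
exists (Num.min (t - c) (d - t)); split; first by rewrite lt_min !subr_gt0 ct.
move=> s; rewrite lt_min /cc /= => /andP[]; rewrite !ltr_norml; lra.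
Qed.

Lemma deriv_withinS (S S' : set R) f t (v : R) : S' `<=` S ->
  deriv_within S f t v -> deriv_within S' f t v.
Proof.
move=> SS h e e0; have [del [del0 hd]] := h e e0; exists del; split => //.
by move=> k k0 kd /SS; exact: hd.
Qed.

Lemma primitiveS c d c' d' F f : c <= c' -> d' <= d -> primitive_on c d F f ->
  primitive_on c' d' F f.
Proof.
move=> h1 h2 [cF dF]; split; first exact: within_ccS cF.
by move=> t /andP[a1 a2]; apply: dF; rewrite (le_lt_trans h1 a1) (lt_le_trans a2 h2).
Qed.

Lemma primitive_eq c d F f g : (forall t, c < t < d -> f t = g t) ->
  primitive_on c d F f -> primitive_on c d F g.
Proof. by move=> fg [cF dF]; split => // t tc; rewrite -fg//; exact: dF. Qed.

Lemma primitiveD c d F f G g : primitive_on c d F f -> primitive_on c d G g ->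
  primitive_on c d (fun s => F s + G s) (fun s => f s + g s).
Proof.
move=> [cF dF] [cG dG]; split; first exact: within_ccD.
by move=> t tc; apply: is_deriveD; [exact: dF|exact: dG].
Qed.

Lemma primitiveZ c d F f (v : R) : primitive_on c d F f ->
  primitive_on c d (fun s => v * F s) (fun s => v * f s).
Proof.
move=> [cF dF]; split; first by apply: within_ccM => //; exact: within_cc_cst.
by move=> t tc; apply: is_deriveZ; exact: dF.
Qed.

Lemma primitiveN c d F f : primitive_on c d F f ->
  primitive_on c d (fun s => - F s) (fun s => - f s).
Proof.
move=> [cF dF]; split; first exact: within_ccN.
by move=> t tc; apply: is_deriveN; exact: dF.
Qed.

Lemma primitiveB c d F f G g : primitive_on c d F f -> primitive_on c d G g ->
  primitive_on c d (fun s => F s - G s) (fun s => f s - g s).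
Proof. by move=> pF pG; apply: primitiveD => //; exact: primitiveN. Qed.

Lemma primitiveM c d F f G g : primitive_on c d F f -> primitive_on c d G g ->
  primitive_on c d (fun s => F s * G s) (fun s => f s * G s + F s * g s).
Proof.
move=> [cF dF] [cG dG]; split; first exact: within_ccM.
move=> t tc; have h1 := dF t tc; have h2 := dG t tc.
apply: is_derive_eq (is_deriveM h1 h2) _.
by rewrite addrC; congr (_ + _); rewrite [_ *: _]mulrC.
Qed.

Lemma primitive_cst c d (v : R) : primitive_on c d (fun=> v) (fun=> 0).
Proof. by split => [|t _]; [exact: within_cc_cst|exact: is_derive_cst]. Qed.

Lemma primitive_id c d : primitive_on c d id (fun=> 1).
Proof.
split => [|t _]; last exact: is_derive_id.
by apply: within_cc_cont => x; exact: cvg_id.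
Qed.

Lemma primitive_comp c d F f (h h' : R -> R) : primitive_on c d F f ->
  (forall x, is_derive x (1 : R) h (h' x)) ->
  primitive_on c d (h \o F) (fun s => h' (F s) * f s).
Proof.
move=> [cF dF] dh; have ch : continuous h.
  move=> x; apply: differentiable_continuous; apply/derivable1_diffP.
  by have [] := dh x.
split.
  by move=> x; exact: (cvg_comp _ _ (cF x) (ch (F x))).
move=> t tc; have h1 := dF t tc.
exact: (is_derive_eq (is_derive1_comp (dh (F t)) h1)).
Qed.

(** Serves as a first-order remainder estimate around the slope [v], with an explicit constant that
    can be kept uniform in parameters. *)
Lemma primitive_mvt c d F f (v e : R) : primitive_on c d F f -> c <= d ->
  (forall t, c < t < d -> `|f t - v| <= e) ->
  `|F d - F c - (d - c) * v| <= e * (d - c).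
Proof.
move=> [cF dF]; rewrite le_eqVlt => /predU1P[<-|cd] h.
  by rewrite !subrr mul0r mulr0 subr0 normr0.
have dF' x : x \in `]c, d[ -> is_derive x (1 : R) F (f x).
  by rewrite in_itv /= => xc; exact: dF.
have [t tc ->] := MVT cd dF' cF.
rewrite (mulrC (f t)) -mulrBr normrM mulrC [`|d - c|]gtr0_norm ?subr_gt0//.
by rewrite ler_pM2r ?subr_gt0//; apply: h; move: tc; rewrite in_itv.
Qed.

Lemma primitive_oo c d F f : c < d -> primitive_on c d F f ->
  derivable_oo_LRcontinuous F c d /\ {in `]c, d[, derive1 F =1 f}.
Proof.
move=> cd [cF dF]; have [h1 h2 h3] := (continuous_within_itvP F cd).1 cF.
split; first by split => // x; rewrite in_itv /= => /dF[].
by move=> x; rewrite in_itv /= => /dF[_]; rewrite derive1E.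
Qed.

Lemma primitive_Lint c d F f : c <= d -> primitive_on c d F f ->
  {within `[c, d], continuous f} -> Lint (cc c d) f = F d - F c.
Proof.
rewrite le_eqVlt => /predU1P[<-|cd] pF cf; first by rewrite Lint_cc1 subrr.
have [h1 h2] := primitive_oo cd pF.
by rewrite /Lint ccE /Rintegral (continuous_FTC2 cd cf h1 h2).
Qed.

Lemma Lint_parts c d F f G g : c <= d ->
  primitive_on c d F f -> {within `[c, d], continuous f} ->
  primitive_on c d G g -> {within `[c, d], continuous g} ->
  Lint (cc c d) (fun s => f s * G s) + Lint (cc c d) (fun s => F s * g s) =
  F d * G d - F c * G c.
Proof.
move=> cd pF cf pG cg; rewrite -LintD; last 2 first.
- by apply: within_ccM => //; case: pG.
- by apply: within_ccM => //; case: pF.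
apply: primitive_Lint cd (primitiveM pF pG) _.
by apply: within_ccD; apply: within_ccM => //; [case: pG|case: pF].
Qed.

Lemma Lint_primitive c d f : c <= d -> {within `[c, d], continuous f} ->
  primitive_on c d (fun t => Lint (cc c t) f) f.
Proof.
move=> cd cf; have fi := within_cc_integrable cf; rewrite ccE in fi.
split.
  have := parameterized_integral_continuous cd fi.
  by apply: within_cc_eq => s _; rewrite /Lint ccE.
move=> t /andP[ct td].
have cft : {for t, continuous f}.
  apply: (within_continuous_continuous _ cf); first exact: lt_trans td.
  by rewrite in_itv /= ct.
have [h1 h2] := continuous_FTC1_closed td fi ct cft.
rewrite (_ : (fun u => _) = fun u => \int[lebesgue_measure]_(x in [set` `[c, u]]) f x).
  by apply: DeriveDef; [exact: h1|rewrite -derive1E].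
by apply/funext => u; rewrite /Lint ccE.
Qed.

End Interval.

(** * Iterated integrals *)

Section UniformSwap.
Variable R : realType.

Definition unif_on2 (c d e f : R) (K : R -> R -> R) :=
  forall eps : R, 0 < eps -> exists del : R, 0 < del /\
    forall x x' y y', c <= x <= d -> c <= x' <= d -> e <= y <= f ->
      e <= y' <= f -> `|x' - x| < del -> `|y' - y| < del ->
      `|K x' y' - K x y| < eps.

Lemma unif_on2_sym c d e f K : unif_on2 c d e f K ->
  unif_on2 e f c d (fun y x => K x y).
Proof.
move=> h eps /h[del [del0 hd]]; exists del; split => // *; exact: hd.
Qed.

Lemma unif_on2_l c d e f K x : unif_on2 c d e f K -> c <= x <= d ->
  {within `[e, f], continuous (K x)}.
Proof.
move=> h xc; apply/within_ccP => y ye eps /h[del [del0 hd]]; exists del; split => //.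
by move=> y' y'e yy; apply: hd => //; rewrite subrr normr0.
Qed.

Lemma unif_on2_Lint c d e f K : e <= f -> unif_on2 c d e f K ->
  {within `[c, d], continuous (fun x => Lint (cc e f) (K x))}.
Proof.
move=> ef h; apply/within_ccP => x xc eps eps0.
(* The [+ 1] keeps the divisor positive when [e = f] and makes the final inequality strict. *)
have ef1 : 0 < f - e + 1 by rewrite ltr_wpDl// subr_ge0.
have [del [del0 hd]] := h _ (divr_gt0 eps0 ef1); exists del; split => // x' x'c xx.
have cN1 : {within `[e, f], continuous (fun y => -1 * K x y)}.
  by apply: within_ccM; [exact: within_cc_cst|exact: unif_on2_l h xc].
have -> : Lint (cc e f) (K x') - Lint (cc e f) (K x) =
    Lint (cc e f) (fun y => K x' y + -1 * K x y).
  rewrite LintD//; last exact: unif_on2_l h x'c.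
  by rewrite LintZ ?mulN1r//; exact: unif_on2_l h xc.
apply: (@le_lt_trans _ _ (eps / (f - e + 1) * (f - e))).
  apply: Lint_bound => //.
    by apply: within_ccD => //; exact: unif_on2_l h x'c.
  by move=> y ye; rewrite mulN1r ltW// hd// subrr normr0.
by rewrite -mulrA gtr_pMr// ltr_pdivrMl// mulr1 ltrDl.
Qed.

(* Both sides vanish at [d = c] and have the same derivative in [d]. *)
Lemma Lint_swap c d e f K : c <= d -> e <= f -> unif_on2 c d e f K ->
  Lint (cc c d) (fun x => Lint (cc e f) (K x)) =
  Lint (cc e f) (fun y => Lint (cc c d) (fun x => K x y)).
Proof.
move=> cd ef h.
pose a x := Lint (cc e f) (K x).
pose Q x y := Lint (cc c x) (fun x' => K x' y).
pose Phi x := Lint (cc e f) (Q x).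
have ca : {within `[c, d], continuous a} by exact: unif_on2_Lint.
have hS x : c <= x <= d -> unif_on2 c x e f K.
  move=> /andP[cx xd] eps /h[del [del0 hd]]; exists del; split => //.
  by move=> x1 x2 y1 y2 /andP[? ?] /andP[? ?] *; apply: hd => //; lra.
have cQ x : c <= x <= d -> {within `[e, f], continuous (Q x)}.
  move=> xc; apply: unif_on2_Lint; first by case/andP: xc.
  exact/unif_on2_sym/hS.
have pQ y : e <= y <= f -> primitive_on c d (fun x => Q x y) (fun x => K x y).
  by move=> ye; apply: Lint_primitive => //; exact: unif_on2_l (unif_on2_sym h) ye.
have dPhi x : c <= x <= d -> deriv_within (cc c d) Phi x (a x).
  move=> xc eps eps0.
  have ef1 : 0 < f - e + 1 by rewrite ltr_wpDl// subr_ge0.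
  have [del [del0 hd]] := h _ (divr_gt0 eps0 ef1); exists del; split => //.
  move=> k k0 kd xk.
  (* The increment of Q(., y) is compared with k K(x, y) by the mean value inequality, with a
     constant independent of y; integrating over y then gives the derivative of [Phi]. The two signs
     of k need different intervals. *)
  have bnd y : e <= y <= f ->
      `|Q (x + k) y - Q x y - k * K x y| <= eps / (f - e + 1) * `|k|.
    move=> ye; have pQy := pQ y ye; rewrite /cc /= in xk.
    have [kp|kn] := ltP 0 k.
      have hp : primitive_on x (x + k) (fun x => Q x y) (fun x => K x y).
        by apply: primitiveS pQy; lra.
      have := @primitive_mvt R x (x + k) _ _ (K x y) (eps / (f - e + 1)) hp.
      rewrite (_ : x + k - x = k); last by ring.
      rewrite [`|k|]gtr0_norm//; apply; first lra.
      move=> t ht; apply: ltW; apply: hd => //; try lra.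
        by move: kd; rewrite gtr0_norm// => kd; rewrite ltr_norml; lra.
      by rewrite subrr normr0.
    have kn' : k < 0 by rewrite lt_neqAle k0.
    have hp : primitive_on (x + k) x (fun x => Q x y) (fun x => K x y).
      by apply: primitiveS pQy; lra.
    have := @primitive_mvt R (x + k) x _ _ (K x y) (eps / (f - e + 1)) hp.
    rewrite (_ : x - (x + k) = - k); last by ring.
    rewrite [`|k|]ltr0_norm// -normrN => h1.
    rewrite (_ : Q (x + k) y - Q x y - k * K x y =
      - (Q x y - Q (x + k) y - - k * K x y)); last by ring.
    apply: h1; first lra.
    move=> t ht; apply: ltW; apply: hd => //; try lra.
      by move: kd; rewrite ltr0_norm// => kd; rewrite ltr_norml; lra.
    by rewrite subrr normr0.
  have cxk := cQ _ xk; have cx := cQ _ xc; have cK := unif_on2_l h xc.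
  have cn1 : {within `[e, f], continuous (fun y => -1 * Q x y)}.
    by apply: within_ccM => //; exact: within_cc_cst.
  have cn2 : {within `[e, f], continuous (fun y => - k * K x y)}.
    by apply: within_ccM => //; exact: within_cc_cst.
  have E : Phi (x + k) - Phi x - k * a x = Lint (cc e f)
      (fun y => Q (x + k) y + -1 * Q x y + - k * K x y).
    rewrite LintD//; last exact: within_ccD.
    by rewrite LintD// !LintZ// mulN1r mulNr.
  have -> : (Phi (x + k) - Phi x) / k - a x = (Phi (x + k) - Phi x - k * a x) / k.
    by rewrite [RHS]mulrBl [k * _]mulrC mulfK.
  rewrite normrM normfV E ltr_pdivrMr ?normr_gt0//.
  apply: (@le_lt_trans _ _ (eps / (f - e + 1) * `|k| * (f - e))).
    apply: Lint_bound => //; first by apply: within_ccD => //; exact: within_ccD.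
    by move=> y /bnd; rewrite mulN1r mulNr.
  rewrite mulrAC ltr_pM2r ?normr_gt0// -mulrA gtr_pMr//.
  by rewrite ltr_pdivrMl// mulr1 ltrDl.
rewrite (primitive_Lint cd (deriv_within_primitive dPhi) ca).
rewrite /Phi (_ : Lint _ (Q c) = 0) ?subr0//.
rewrite (_ : Q c = fun=> 0); first by rewrite Lint_cst// mul0r.
by apply/funext => y; rewrite /Q Lint_cc1.
Qed.

End UniformSwap.

Section Upd.
Variables (R : realType) (I : finType).
Implicit Types (p q : I -> R) (k : I) (x y : R).

Lemma upd_same p k y : upd p k y k = y.
Proof. by rewrite /upd eqxx. Qed.

Lemma upd_neq p k y k' : k' != k -> upd p k y k' = p k'.
Proof. by rewrite /upd => /negbTE ->. Qed.

Lemma updd p k x y : upd (upd p k x) k y = upd p k y.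
Proof. by apply/funext => k'; rewrite /upd; case: eqP. Qed.

Lemma upd_id p k : upd p k (p k) = p.
Proof. by apply/funext => k'; rewrite /upd; case: eqP => // ->. Qed.

Lemma updC p k k' x y : k != k' ->
  upd (upd p k x) k' y = upd (upd p k' y) k x.
Proof.
move=> kk; apply/funext => i; rewrite /upd; case: eqP => [->|//].
by rewrite eq_sym (negbTE kk).
Qed.

Lemma box_upd (l h : I -> R) p k y : box l h p -> l k <= y <= h k ->
  box l h (upd p k y).
Proof. by move=> hp hy i; rewrite /upd; case: eqP => [->|]. Qed.

End Upd.

Section IteratedIntegral.
Variables (R : realType) (I : finType) (l h : I -> R).
Implicit Types (F G : (I -> R) -> R) (p q : I -> R) (k : I) (s : seq I).
Local Notation B := (box l h).

Definition Lint_at k G p := Lint (cc (l k) (h k)) (fun y => G (upd p k y)).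

(** The head of the list is the outermost integral. Values remain functions of the whole point,
    whose coordinates in [s] are overwritten, so that the operators can be composed and permuted. *)
Definition mint s G := foldr Lint_at G s.

Lemma box_le p k : B p -> l k <= h k.
Proof. by move=> /(_ k) /andP[]; exact: le_trans. Qed.

Lemma cont_on_slice G p k : cont_on B G -> B p ->
  {within `[l k, h k], continuous (fun y => G (upd p k y))}.
Proof.
move=> cG Bp; apply/within_ccP => s sc e e0.
have [d [d0 hd]] := cG (upd p k s) (box_upd Bp sc) e e0.
exists d; split => // t tc ts; apply: hd; first exact: box_upd.
by move=> i; rewrite /upd; case: eqP => // _; rewrite subrr normr0.
Qed.

Lemma cont_on_unif_on2 G p k k' : cont_on B G -> B p -> k != k' ->
  unif_on2 (l k) (h k) (l k') (h k') (fun x y => G (upd (upd p k x) k' y)).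
Proof.
move=> /cont_on_box_unif uG Bp kk e /uG[d [d0 hd]]; exists d; split => //.
move=> x x' y y' xc x'c yc y'c xx yy.
apply: hd; [by do 2 apply: box_upd => //..|].
move=> i; rewrite /upd; case: eqP => // _; case: eqP => // _.
by rewrite subrr normr0.
Qed.

Lemma Lint_at_cont k G : cont_on B G -> cont_on B (Lint_at k G).
Proof.
move=> cG p Bp e e0; have lh := box_le k Bp.
have lh1 : 0 < h k - l k + 1 by rewrite ltr_wpDl// subr_ge0.
have [d [d0 hd]] := cont_on_box_unif cG (divr_gt0 e0 lh1).
exists d; split => // q Bq hq.
have c1 := cont_on_slice (k := k) cG Bp; have c2 := cont_on_slice (k := k) cG Bq.
have c1' : {within `[l k, h k], continuous (fun y => -1 * G (upd p k y))}.
  by apply: within_ccM => //; exact: within_cc_cst.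
have -> : Lint_at k G q - Lint_at k G p =
    Lint (cc (l k) (h k)) (fun y => G (upd q k y) + -1 * G (upd p k y)).
  by rewrite LintD// LintZ// mulN1r.
apply: (@le_lt_trans _ _ (e / (h k - l k + 1) * (h k - l k))).
  apply: Lint_bound => //; first exact: within_ccD.
  move=> y yc; rewrite mulN1r ltW// hd//; [exact: box_upd..|].
  by move=> i; rewrite /upd; case: eqP => // _; rewrite subrr normr0.
by rewrite -mulrA gtr_pMr// ltr_pdivrMl// mulr1 ltrDl.
Qed.

Lemma mint_cont s G : cont_on B G -> cont_on B (mint s G).
Proof. by move=> cG; elim: s => //= k s IH; exact: Lint_at_cont. Qed.

Lemma Lint_at_eq k G G' : (forall p, B p -> G p = G' p) ->
  forall p, B p -> Lint_at k G p = Lint_at k G' p.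
Proof. by move=> GG p Bp; apply: Lint_eq => y yc; apply: GG; exact: box_upd. Qed.

Lemma mint_eq s G G' : (forall p, B p -> G p = G' p) ->
  forall p, B p -> mint s G p = mint s G' p.
Proof. by move=> GG; elim: s => //= k s IH p Bp; exact: Lint_at_eq. Qed.

Lemma mintD s G G' : cont_on B G -> cont_on B G' -> forall p, B p ->
  mint s (fun q => G q + G' q) p = mint s G p + mint s G' p.
Proof.
move=> cG cG'; elim: s => //= k s IH p Bp.
rewrite (Lint_at_eq k IH Bp) /Lint_at LintD//.
  exact: cont_on_slice (mint_cont s cG) Bp.
exact: cont_on_slice (mint_cont s cG') Bp.
Qed.

Lemma mintZ s G (v : R) : cont_on B G -> forall p, B p ->
  mint s (fun q => v * G q) p = v * mint s G p.
Proof.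
move=> cG; elim: s => //= k s IH p Bp.
rewrite (Lint_at_eq k IH Bp) /Lint_at LintZ//.
exact: cont_on_slice (mint_cont s cG) Bp.
Qed.

Lemma mint_sum s (J : Type) (r : seq J) (G : J -> (I -> R) -> R) :
  (forall j, cont_on B (G j)) -> forall p, B p ->
  mint s (fun q => \sum_(j <- r) G j q) p = \sum_(j <- r) mint s (G j) p.
Proof.
move=> cG p Bp; elim: r => [|j r IH].
  rewrite big_nil (@mint_eq s _ (fun q => 0 * (fun=> 0) q))//; last first.
    by move=> q _; rewrite big_nil mul0r.
  by rewrite mintZ ?mul0r//; exact: cont_on_cst.
rewrite big_cons (@mint_eq s _ (fun q => G j q + \sum_(i <- r) G i q))//; last first.
  by move=> q _; rewrite big_cons.
by rewrite mintD ?IH//; apply: cont_on_sum.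
Qed.

Lemma Lint_atC k k' G : cont_on B G -> forall p, B p ->
  Lint_at k (Lint_at k' G) p = Lint_at k' (Lint_at k G) p.
Proof.
move=> cG p Bp; have [->//|kk] := eqVneq k k'.
rewrite /Lint_at (Lint_swap (K := fun x y => G (upd (upd p k x) k' y))).
- by apply: Lint_eq => y _; apply: Lint_eq => x _; rewrite updC.
- exact: box_le Bp.
- exact: box_le Bp.
- exact: cont_on_unif_on2.
Qed.

Lemma mint_Lint_at s k G : cont_on B G -> forall p, B p ->
  Lint_at k (mint s G) p = mint s (Lint_at k G) p.
Proof.
move=> cG; elim: s => //= k' s IH p Bp.
rewrite Lint_atC//; last exact: mint_cont.
by apply: Lint_at_eq.
Qed.

(** Moves the integral over [k] innermost, where all other coordinates are frozen and a statement
    about one variable can be applied. *)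
Lemma mint_innermost s k G : k \in s -> cont_on B G -> forall p, B p ->
  mint s G p = mint (rem k s) (Lint_at k G) p.
Proof.
elim: s => //= k' s IH; rewrite inE; have [-> _|kk /= ks] := eqVneq k' k.
  exact: mint_Lint_at.
move=> cG p Bp; apply: Lint_at_eq => // q Bq; exact: IH.
Qed.

Lemma mint_indep s G p q : (forall k, k \notin s -> p k = q k) ->
  mint s G p = mint s G q.
Proof.
elim: s p q => [|k s IH] p q pq.
  by congr G; apply/funext => k; exact: pq.
apply: Lint_eq => y _; apply: IH => i /negbTE si.
rewrite /upd; case: eqP => // /eqP ik; apply: pq.
by rewrite inE negb_or ik si.
Qed.

Lemma mint_pull (c : R -> R) s k G : k \notin s -> cont_on B G ->
  forall p, B p -> mint s (fun q => c (q k) * G q) p = c (p k) * mint s G p.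
Proof.
move=> + cG; elim: s => //= k' s IH; rewrite inE negb_or => /andP[kk ks] p Bp.
rewrite (Lint_at_eq k' (IH ks) Bp) /Lint_at -LintZ; last first.
  exact: cont_on_slice (mint_cont s cG) Bp.
by apply: Lint_eq => y _; rewrite upd_neq.
Qed.

(** Induction on the coordinates. With the factors for [s] fixed, the inner integral is a continuous
    function of the outermost coordinate and orthogonal to all of [T k], hence zero at every value
    of it; then [p] may be moved to the value of [q] in that coordinate. The families [T k] enter
    through three properties only: continuity, nonemptiness and the fundamental lemma in one
    variable. *)
Lemma mint_fundamental (T : I -> set (R -> R)) s G p :
  (forall k phi, T k phi -> continuous phi) ->
  (forall k, exists phi, T k phi) ->
  (forall k f, {within `[l k, h k], continuous f} ->
     (forall phi, T k phi -> Lint (cc (l k) (h k)) (fun y => phi y * f y) = 0) ->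
     forall y, l k <= y <= h k -> f y = 0) ->
  uniq s -> cont_on B G -> B p ->
  (forall Phi : I -> R -> R, (forall k, T k (Phi k)) ->
     mint s (fun q => G q * \prod_(k <- s) Phi k (q k)) p = 0) ->
  forall q, B q -> (forall k, k \notin s -> q k = p k) -> G q = 0.
Proof.
move=> Tc Tex T1; elim: s p => [|k s IH] p.
  move=> _ cG Bp hG q Bq qp.
  (* No integral and an empty product remain, yet the hypothesis still asks for a family [Phi]. *)
  have /choice[Phi hPhi] := Tex; have := hG Phi hPhi.
  by rewrite /= big_nil mulr1 => <-; congr G; apply/funext => k; exact: qp.
rewrite /= => /andP[ks us] cG Bp hG q Bq qp.
apply: (IH (upd p k (q k))) => //.
- exact: box_upd.
- move=> Phi hPhi.
  have cP : cont_on B (fun q => G q * \prod_(i <- s) Phi i (q i)).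
    apply: cont_onM => //; apply: cont_on_prod => i _ u _ e e0.
    have /cvgrPdist_lt/(_ e e0)/nbhs_ballP[d /= d0 hd] := Tc i _ (hPhi i) (u i).
    by exists d; split => // v _ uv; rewrite distrC; apply: hd; rewrite /ball /= distrC.
  apply: (T1 k (fun y => mint s (fun q => G q * \prod_(i <- s) Phi i (q i)) (upd p k y))) => //.
    exact: cont_on_slice (mint_cont s cP) Bp.
  move=> phi Tphi.
  have := hG (fun i => if i == k then phi else Phi i).
  move=> <-; last by move=> i; case: eqP => // ->.
  apply: Lint_eq => y yc.
  have Bu := box_upd Bp yc.
  have := mint_pull phi ks cP Bu; rewrite upd_same => <-.
  apply: mint_eq => // r _; rewrite big_cons eqxx mulrCA; congr (_ * (_ * _)).
  rewrite !big_seq; apply: eq_bigr => i is'; case: eqP => // ik.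
  by rewrite -ik is' in ks.
- move=> i is'; rewrite /upd; case: eqP => [->//|/eqP ik].
  by apply: qp; rewrite inE negb_or ik is'.
Qed.

End IteratedIntegral.

(** * Weakly singular kernels *)

Section ImproperIntegrals.
Variable R : realType.
Implicit Types (c d t : R) (f g F : R -> R).
Local Notation mu := (@lebesgue_measure R).

(** The function may blow up at both ends. On the compact intervals [A n] the fundamental theorem
    applies; they increase to the open interval, so monotone convergence gives the limit of the
    integrals, and continuity of [F] up to the ends that of its increments. *)
Lemma integral_primitive_oo c d F f : c < d -> primitive_on c d F f ->
  (forall t, c < t < d -> {for t, continuous f}) ->
  (forall t, c < t < d -> 0 <= f t) ->
  (\int[mu]_(x in `]c, d[) (f x)%:E = (F d - F c)%:E)%E.
Proof.
move=> cd pF cf f0.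
(* Half the length, so that no [A n] is empty; [A 0] is the midpoint. *)
pose w := (d - c) / 2.
have w0 : 0 < w by rewrite divr_gt0// subr_gt0.
pose e n : R := w * n.+1%:R^-1.
have e0 n : 0 < e n by rewrite mulr_gt0.
have ew n : e n <= w by rewrite ger_pMr// invf_le1// ler1n.
have hw : c + w = d - w by rewrite /w; field.
pose A n := `[c + e n, d - e n]%classic.
have mA n : measurable (A n) by exact: measurable_itv.
have ndA : nondecreasing_seq A.
  move=> m n mn; rewrite subsetEset => x; rewrite /A /= !in_itv /=.
  have : e n <= e m by rewrite ler_pM2l// lef_pV2 ?posrE// ler_nat.
  by move=> h /andP[h1 h2]; apply/andP; split; lra.
have Asub n : A n `<=` `]c, d[%classic.
  move=> x; rewrite /A /= !in_itv /= => /andP[h1 h2].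
  by have e0n := e0 n; apply/andP; split; lra.
have cfo : {in `]c, d[%classic, continuous f}.
  by move=> x; rewrite inE /= in_itv /= => /cf.
have mf : measurable_fun `]c, d[ f.
  by apply: open_continuous_measurable_fun => //; exact: interval_open.
have bigA : \bigcup_n A n = `]c, d[%classic.
  apply/seteqP; split; first by move=> x [n _] /Asub.
  move=> x; rewrite /= in_itv /= => /andP[cx xd].
  have m0 : 0 < Num.min (x - c) (d - x) / w.
    by rewrite divr_gt0// lt_min !subr_gt0 cx.
  have [n _ /(_ n (leqnn n)) /= hn] := near_infty_natSinv_lt (PosNum m0).
  exists n => //; rewrite /A /= in_itv /=.
  have : e n < Num.min (x - c) (d - x) by rewrite /e mulrC -ltr_pdivlMr.
  by rewrite lt_min => /andP[h1 h2]; apply/andP; split; lra.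
have := @ge0_nondecreasing_set_cvg_integral _ (measurableTypeR R) R A (EFin \o f) mu ndA mA.
rewrite bigA => /(_ _ _)/cvg_lim <-//; last 2 first.
- by move=> n; apply/measurable_EFinP; apply: measurable_funS mf.
- by move=> n x /Asub; rewrite /= in_itv /= lee_fin => /f0.
apply/cvg_lim => //.
have IA n : (\int[mu]_(x in A n) (EFin \o f) x)%E = (F (d - e n) - F (c + e n))%:E.
  have le : c + e n <= d - e n by have := ew n; lra.
  have hp : primitive_on (c + e n) (d - e n) F f.
    by have e0n := e0 n; apply: primitiveS pF; lra.
  have hc : {within `[c + e n, d - e n], continuous f}.
    apply: continuous_in_subspaceT => x; rewrite inE => /Asub.
    by rewrite /= in_itv /=; exact: cf.
  rewrite -(primitive_Lint le hp hc) /Lint /Rintegral ccE fineK//.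
  apply: integrable_fin_num => //.
  by have := within_cc_integrable hc; rewrite ccE.
under eq_fun do rewrite IA.
apply: cvg_EFin; first by near=> n.
have [/within_ccP cF _] := pF.
apply/cvgrPdist_lt => eps eps0.
have ccd : c <= c <= d by rewrite lexx ltW.
have dcd : c <= d <= d by rewrite lexx ltW.
have [d1 [d10 h1]] := cF c ccd _ (divr_gt0 eps0 (ltr0Sn _ 1)).
have [d2 [d20 h2]] := cF d dcd _ (divr_gt0 eps0 (ltr0Sn _ 1)).
have m0 : 0 < Num.min d1 d2 / w by rewrite divr_gt0// lt_min d10.
near=> n; rewrite /comp /=.
have hn : e n < Num.min d1 d2.
  by rewrite /e mulrC -ltr_pdivlMr//; near: n; exact: (near_infty_natSinv_lt (PosNum m0)).
have e00 := e0 n; have ew0 := ew n.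
move: hn; rewrite lt_min => /andP[n1 n2].
have g1 : `|F (c + e n) - F c| < eps / 2.
  apply: h1; first by apply/andP; split; lra.
  by rewrite addrAC subrr add0r gtr0_norm.
have g2 : `|F (d - e n) - F d| < eps / 2.
  apply: h2; first by apply/andP; split; lra.
  by rewrite addrAC subrr add0r normrN gtr0_norm.
rewrite (_ : _ - _ = (F (c + e n) - F c) - (F (d - e n) - F d)); last by ring.
by apply: le_lt_trans (ler_normB _ _) _; lra.
Unshelve. all: by end_near. Qed.

End ImproperIntegrals.

Section TruncatedPowers.
Variable R : realType.
Implicit Types (x y r : R).

(* The truncation must be explicit: [x `^ r] is 1, not 0, for [x < 0]. *)
Definition tpow r x := Num.max x 0 `^ r.

Lemma tpow_ge r x : 0 <= x -> tpow r x = x `^ r.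
Proof. by move=> x0; rewrite /tpow max_l. Qed.

Lemma tpow_le r x : r != 0 -> x <= 0 -> tpow r x = 0.
Proof. by move=> r0 x0; rewrite /tpow max_r// powR0. Qed.

Lemma tpow_ge0 r x : 0 <= tpow r x.
Proof. exact: powR_ge0. Qed.

Lemma tpow_lt r e x : 0 < r -> 0 < e -> `|x| < e `^ r^-1 -> tpow r x < e.
Proof.
move=> r0 e0 xe; have [x0|x0] := leP x 0; first by rewrite tpow_le// gt_eqF.
rewrite tpow_ge ?ltW// (_ : e = (e `^ r^-1) `^ r); last first.
  by rewrite -powRrM mulVf ?gt_eqF// powRr1// ltW.
apply: gt0_ltr_powR => //; rewrite ?nnegrE ?powR_ge0// ?ltW//.
by rewrite gtr0_norm in xe.
Qed.

Lemma nbhs_pos x (P : set R) : 0 < x -> (forall y, 0 < y -> P y) -> nbhs x P.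
Proof.
move=> x0 hP; apply/nbhs_ballP; exists x => //= y.
by rewrite /ball /= ltr_norml => /andP[_ h]; apply: hP; lra.
Qed.

Lemma nbhs_neg x (P : set R) : x < 0 -> (forall y, y < 0 -> P y) -> nbhs x P.
Proof.
move=> x0 hP; apply/nbhs_ballP; exists (- x); first by rewrite /= oppr_gt0.
by move=> y; rewrite /ball /= ltr_norml => /andP[h _]; apply: hP; lra.
Qed.

Lemma tpow_derive_pos r x : 0 < x ->
  is_derive x (1 : R) (tpow r) (r * x `^ (r - 1)).
Proof.
move=> x0; apply: (@near_eq_is_derive _ _ _ (fun y => y `^ r)).
  by apply: nbhs_pos => // y y0; rewrite tpow_ge// ltW.
exact: is_derive1_powR.
Qed.

Lemma tpow_derive_neg r x : r != 0 -> x < 0 -> is_derive x (1 : R) (tpow r) 0.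
Proof.
move=> r0 x0; apply: (@near_eq_is_derive _ _ _ (fun=> 0)).
by apply: nbhs_neg => // y y0; rewrite tpow_le// ltW.
Qed.

(** Only the origin needs care: there the quotient is 0 on the left and k^(r - 1) on the right,
    which tends to 0 because r > 1. *)
Lemma tpow_derive r x : 1 < r ->
  is_derive x (1 : R) (tpow r) (r * tpow (r - 1) x).
Proof.
move=> r1; have r0 : r != 0 by rewrite gt_eqF// (lt_trans ltr01).
have r10 : 0 < r - 1 by rewrite subr_gt0.
have [x0|x0|->] := ltgtP x 0.
- by rewrite [tpow (r - 1) x]tpow_le ?mulr0 ?gt_eqF ?ltW//; exact: tpow_derive_neg.
- by rewrite [tpow (r - 1) x]tpow_ge ?ltW//; exact: tpow_derive_pos.
rewrite [tpow (r - 1) 0]tpow_le ?gt_eqF// mulr0.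
apply: (@deriv_within_is_derive _ setT); first by exists 1.
move=> e e0; exists (e `^ (r - 1)^-1); split; first exact: powR_gt0.
move=> k k0 ke _; rewrite add0r subr0 [tpow r 0]tpow_le// subr0.
have [kn|kp] := leP k 0; first by rewrite tpow_le// mul0r normr0.
rewrite tpow_ge ?ltW// -(mulr_powRB1 (ltW kp)) ?(lt_trans ltr01)//.
rewrite mulrAC divff// mul1r ger0_norm ?powR_ge0//.
by have := tpow_lt r10 e0 ke; rewrite tpow_ge// ltW.
Qed.

Lemma tpow_cont r : 0 < r -> continuous (tpow r).
Proof.
move=> r0 x; have r0' : r != 0 by rewrite gt_eqF.
have der v : is_derive x (1 : R) (tpow r) v -> {for x, continuous (tpow r)}.
  by move=> [h _]; apply: differentiable_continuous; apply/derivable1_diffP.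
have [x0|x0|->] := ltgtP x 0.
- by apply: der; apply: tpow_derive_neg.
- by apply: der; apply: tpow_derive_pos.
apply/cvgrPdist_lt => e e0; apply/nbhs_ballP; exists (e `^ r^-1).
  exact: powR_gt0.
move=> y; rewrite /ball /= sub0r normrN => ye.
by rewrite [tpow r 0]tpow_le// sub0r normrN ger0_norm ?tpow_ge0//; exact: tpow_lt.
Qed.

Lemma tpow1 x : tpow 1 x = Num.max x 0.
Proof. by rewrite /tpow powRr1// le_max lexx orbT. Qed.

Lemma tpow2 x : tpow 2 x = Num.max x 0 ^+ 2.
Proof. by rewrite /tpow -powR_mulrn// le_max lexx orbT. Qed.

Lemma is_derive_translate (f : R -> R) x (c v : R) :
  is_derive (x - c) (1 : R) f v -> is_derive x (1 : R) (fun y => f (y - c)) v.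
Proof.
move=> h; have h1 : is_derive x (1 : R) (fun y => y - c) 1.
  by apply: is_derive_eq (is_deriveB (is_derive_id x 1) (is_derive_cst c x 1)) _; rewrite subr0.
have h2 := @is_derive1_comp _ f (fun y => y - c) x _ _ h h1.
by apply: is_derive_eq h2 _; rewrite mulr1.
Qed.

Lemma is_derive_reflect (f : R -> R) x (c v : R) :
  is_derive (c - x) (1 : R) f v -> is_derive x (1 : R) (fun y => f (c - y)) (- v).
Proof.
move=> h; have h1 : is_derive x (1 : R) (fun y => c - y) (- 1).
  by apply: is_derive_eq (is_deriveB (is_derive_cst c x 1) (is_derive_id x 1)) _; rewrite sub0r.
have h2 := @is_derive1_comp _ f (fun y => c - y) x _ _ h h1.
by apply: is_derive_eq h2 _; rewrite mulrN1.
Qed.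

Lemma continuous_translate (f : R -> R) c : continuous f -> continuous (fun y => f (y - c)).
Proof.
move=> cf x; apply: (@continuous_comp _ _ _ (fun y : R => y - c) f); last exact: cf.
by apply: continuousB; [exact: cvg_id|exact: cst_continuous].
Qed.

Lemma continuous_reflect (f : R -> R) c : continuous f -> continuous (fun y => f (c - y)).
Proof.
move=> cf x; apply: (@continuous_comp _ _ _ (fun y : R => c - y) f); last exact: cf.
by apply: continuousB; [exact: cst_continuous|exact: cvg_id].
Qed.

End TruncatedPowers.

Section WeaklySingularKernel.
Variables (R : realType) (g : R).
Hypothesis g01 : 0 < g < 1.
Implicit Types (c d s t : R) (f psi : R -> R).
Local Notation mu := (@lebesgue_measure R).

Let g1 : 0 < 1 - g. Proof. by case/andP: g01; rewrite subr_gt0. Qed.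

Lemma measurable_kernel_l s : measurable_fun setT (fun x : R => (s - x) `^ (- g)).
Proof.
apply: (measurableT_comp (f := fun y : R => y `^ (- g)) (g := fun x : R => s - x)) => //.
exact: measurable_funB.
Qed.

Lemma measurable_kernel_r s : measurable_fun setT (fun x : R => (x - s) `^ (- g)).
Proof.
apply: (measurableT_comp (f := fun y : R => y `^ (- g)) (g := fun x : R => x - s)) => //.
exact: measurable_funB.
Qed.

(** The primitive -(s - x)^(1 - g)/(1 - g) is continuous up to the singular end because g < 1. The
    end itself is null, so the value that [powR] takes at 0 is immaterial. *)
Lemma kernel_integral_l c s : c <= s ->
  (\int[mu]_(x in cc c s) ((s - x) `^ (- g))%:E = ((s - c) `^ (1 - g) / (1 - g))%:E)%E.
Proof.
rewrite le_eqVlt => /predU1P[<-|cs].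
  by rewrite ccE set_itv1 integral_set1 subrr powR0 ?gt_eqF// mul0r.
rewrite ccE integral_itv_bndoo; last first.
  apply/measurable_EFinP; apply: measurable_funS (measurable_kernel_l s) => //.
have pk : primitive_on c s (fun x => - (1 - g)^-1 * tpow (1 - g) (s - x))
    (fun x => (s - x) `^ (- g)).
  apply: (@primitive_eq _ _ _ _
    (fun x => - (1 - g)^-1 * - ((1 - g) * (s - x) `^ (1 - g - 1)))).
    move=> t _; rewrite mulrNN mulrA mulVf ?gt_eqF// mul1r.
    by congr (_ `^ _); ring.
  apply: primitiveZ; split.
    by apply: within_cc_cont; exact: continuous_reflect (tpow_cont g1).
  move=> t /andP[ct ts]; apply: is_derive_reflect; apply: tpow_derive_pos.
  by rewrite subr_gt0.
rewrite (integral_primitive_oo cs pk).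
- rewrite subrr [tpow _ 0]tpow_le ?gt_eqF// mulr0 sub0r mulNr opprK mulrC.
  by rewrite tpow_ge// subr_ge0 ltW.
- move=> t /andP[ct ts].
  have st : 0 < s - t by rewrite subr_gt0.
  have [h _] := is_derive_reflect (is_derive1_powR (- g) st).
  by apply: differentiable_continuous; apply/derivable1_diffP.
- by move=> t _; exact: powR_ge0.
Qed.

Lemma kernel_integral_r s d : s <= d ->
  (\int[mu]_(x in cc s d) ((x - s) `^ (- g))%:E = ((d - s) `^ (1 - g) / (1 - g))%:E)%E.
Proof.
rewrite le_eqVlt => /predU1P[<-|sd].
  by rewrite ccE set_itv1 integral_set1 subrr powR0 ?gt_eqF// mul0r.
rewrite ccE integral_itv_bndoo; last first.
  apply/measurable_EFinP; apply: measurable_funS (measurable_kernel_r s) => //.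
have pk : primitive_on s d (fun x => (1 - g)^-1 * tpow (1 - g) (x - s))
    (fun x => (x - s) `^ (- g)).
  apply: (@primitive_eq _ _ _ _
    (fun x => (1 - g)^-1 * ((1 - g) * (x - s) `^ (1 - g - 1)))).
    move=> t _; rewrite mulrA mulVf ?gt_eqF// mul1r.
    by congr (_ `^ _); ring.
  apply: primitiveZ; split.
    by apply: within_cc_cont; exact: continuous_translate (tpow_cont g1).
  move=> t /andP[st td]; apply: is_derive_translate; apply: tpow_derive_pos.
  by rewrite subr_gt0.
rewrite (integral_primitive_oo sd pk).
- rewrite subrr [tpow _ 0]tpow_le ?gt_eqF// mulr0 subr0 mulrC.
  by rewrite tpow_ge// subr_ge0 ltW.
- move=> t /andP[st td].
  have ts : 0 < t - s by rewrite subr_gt0.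
  have [h _] := is_derive_translate (is_derive1_powR (- g) ts).
  by apply: differentiable_continuous; apply/derivable1_diffP.
- by move=> t _; exact: powR_ge0.
Qed.

Lemma kernel_integrable_l c s f : {within `[c, s], continuous f} ->
  mu.-integrable (cc c s) (EFin \o (fun x => (s - x) `^ (- g) * f x)).
Proof.
move=> cf; have mcc := @cc_measurable R c s.
have [cs|sc] := leP c s; last first.
  rewrite ccE set_itv_ge ?bnd_simp -?ltNge//; exact: integrable_set0.
have [M [M0 hM]] := within_cc_bounded cf.
apply: (@integrableMl _ _ _ mu _ mcc (fun x => ((s - x) `^ (- g))%:E) f).
- apply/integrableP; split.
    by apply/measurable_EFinP; apply: measurable_funS (measurable_kernel_l s).
  under eq_integral do rewrite gee0_abs ?lee_fin ?powR_ge0//.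
  by rewrite kernel_integral_l// ltry.
- by rewrite ccE; apply: subspace_continuous_measurable_fun.
- by exists M; split; [exact: num_real|move=> x Mx y /hM/le_trans; apply; exact: ltW].
Qed.

Lemma kernel_integrable_r s d f : {within `[s, d], continuous f} ->
  mu.-integrable (cc s d) (EFin \o (fun x => (x - s) `^ (- g) * f x)).
Proof.
move=> cf; have mcc := @cc_measurable R s d.
have [sd|ds] := leP s d; last first.
  rewrite ccE set_itv_ge ?bnd_simp -?ltNge//; exact: integrable_set0.
have [M [M0 hM]] := within_cc_bounded cf.
apply: (@integrableMl _ _ _ mu _ mcc (fun x => ((x - s) `^ (- g))%:E) f).
- apply/integrableP; split.
    by apply/measurable_EFinP; apply: measurable_funS (measurable_kernel_r s).
  under eq_integral do rewrite gee0_abs ?lee_fin ?powR_ge0//.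
  by rewrite kernel_integral_r// ltry.
- by rewrite ccE; apply: subspace_continuous_measurable_fun.
- by exists M; split; [exact: num_real|move=> x Mx y /hM/le_trans; apply; exact: ltW].
Qed.

End WeaklySingularKernel.

(** * Fractional integration by parts *)

Section FractionalIntegrals.
Variables (R : realType) (g : R).
Hypothesis g01 : 0 < g < 1.
Implicit Types (c d s t : R) (f psi : R -> R).
Local Notation mu := (@lebesgue_measure R).

Let g1 : 0 < 1 - g. Proof. by case/andP: g01; rewrite subr_gt0. Qed.

Lemma integral_EFin_mkcond (D : set R) f :
  (\int[mu]_(x in D) (f x)%:E = \int[mu]_x ((f \_ D) x)%:E)%E.
Proof. by rewrite integral_mkcond; apply: eq_integral => x _; rewrite !patchE; case: ifP. Qed.

(** [Lint] returns 0 for an infinite integral, so positivity requires finiteness as well. Above,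
    t^(-g) on [0, 1] and the exponential density beyond 1 dominate the integrand; below, it is at
    least e^(-1) t^(-g) on (0, 1). *)
Lemma Gamma_gt0 : 0 < Gamma (1 - g).
Proof.
have gE : 1 - g - 1 = - g by ring.
rewrite /Gamma /Lint gE.
have -> : [set t : R | 0 < t] = `]0, +oo[%classic.
  by apply/seteqP; split => t; rewrite /= in_itv /= andbT.
pose h t := t `^ (- g) * expR (- t).
have mh : measurable_fun setT h.
  apply: measurable_funM => //; apply: measurableT_comp => //.
pose D : set R := `]0, +oo[%classic.
have mD : measurable D by exact: measurable_itv.
have h0 t : 0 <= h t by rewrite mulr_ge0 ?powR_ge0 ?expR_ge0.
have k01 : (\int[mu]_(x in cc 0 1) (x `^ (- g))%:E = ((1 - g)^-1)%:E)%E.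
  have := kernel_integral_r g01 (@ler01 R).
  rewrite subr0 powR1 div1r => <-; apply: eq_integral => x _; by rewrite subr0.
have up : (\int[mu]_(x in D) (h x)%:E < +oo)%E.
  pose f1 := (fun t : R => t `^ (- g)) \_ (cc 0 1).
  have mf1 : measurable_fun setT f1.
    apply/(measurable_restrictT _ _).1; first exact: cc_measurable.
    exact: measurable_funTS (measurable_powR (- g)).
  have mf2 := measurable_exponential_pdf (1 : R).
  apply: (@le_lt_trans _ _ (\int[mu]_x ((f1 x)%:E + (exponential_pdf 1 x)%:E))%E).
    apply: (@le_trans _ _ (\int[mu]_(x in D) ((f1 x)%:E + (exponential_pdf 1 x)%:E))%E).
      apply: ge0_le_integral => //=.
      - by move=> x _; rewrite lee_fin h0.
      - by apply/measurable_EFinP; exact: measurable_funTS mh.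
      - apply/measurable_EFinP; apply: measurable_funTS.
        exact: measurable_funD.
      - move=> x; rewrite /D /= in_itv /= andbT => x0.
        rewrite -EFinD lee_fin (exponential_pdfE _ (ltW x0)) mul1r mulN1r /f1 patchE.
        have [x1|x1] := leP x 1.
          rewrite mem_set; last by rewrite /cc /= x1 ltW.
          apply: (@le_trans _ _ (x `^ (- g))); last by rewrite lerDl expR_ge0.
          by rewrite /h ler_piMr ?powR_ge0// -expR0 ler_expR oppr_le0 ltW.
        rewrite memNset; last by rewrite /cc /= => /andP[_]; rewrite leNgt x1.
        rewrite add0r ler_piMl ?expR_ge0//.
        rewrite powRN invf_le1 ?powR_gt0// -(powRr0 x) ler_powR// ?ltW//.
        by case/andP: g01.
    apply: ge0_subset_integral => //=.
      by apply/measurable_EFinP; exact: measurable_funD.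
    by move=> x _; rewrite -EFinD lee_fin addr_ge0// ?exponential_pdf_ge0//
          /f1 patchE; case: ifP; rewrite ?powR_ge0.
  rewrite ge0_integralD//=; last 4 first.
  - by move=> x _; rewrite lee_fin /f1 patchE; case: ifP; rewrite ?powR_ge0.
  - exact/measurable_EFinP.
  - by move=> x _; rewrite lee_fin exponential_pdf_ge0.
  - exact/measurable_EFinP.
  rewrite integral_exponential_pdf// /f1.
  by rewrite -integral_EFin_mkcond k01 -EFinD ltry.
have lo : (0 < \int[mu]_(x in D) (h x)%:E)%E.
  have mc : measurable_fun (cc 0 1) (EFin \o fun x : R => expR (- 1) * x `^ (- g)).
    apply/measurable_EFinP; apply: measurable_funM => //.
    exact: measurable_funTS (measurable_powR (- g)).
  apply: (@lt_le_trans _ _ (\int[mu]_(x in `]0%R, 1%R[) (expR (- 1) * x `^ (- g))%:E)%E).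
    rewrite -(@integral_itv_bndoo _ 0 1 _ true false); last first.
      by apply: measurable_funS mc; [exact: cc_measurable|rewrite ccE; exact: subset_itv_oo_cc].
    rewrite -ccE; under eq_integral do rewrite EFinM.
    have mc01 := @cc_measurable R 0 1.
    have ic : mu.-integrable (cc 0 1) (fun x => (x `^ (- g))%:E).
      have := @kernel_integrable_r R g g01 0 1 (fun=> 1) (@within_cc_cst _ _ _ _).
      by congr (_.-integrable _ _); apply/funext => x; rewrite /= subr0 mulr1.
    rewrite integralZl//.
    by rewrite k01 -EFinM lte_fin mulr_gt0 ?expR_gt0 ?invr_gt0.
  apply: (@le_trans _ _ (\int[mu]_(x in `]0%R, 1%R[) (h x)%:E)%E).
    apply: ge0_le_integral => //=.
    - by move=> x _; rewrite lee_fin mulr_ge0 ?powR_ge0 ?expR_ge0.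
    - by apply: measurable_funS mc; [exact: cc_measurable|rewrite ccE; exact: subset_itv_oo_cc].
    - by apply/measurable_EFinP; exact: measurable_funTS mh.
    - move=> x; rewrite /= in_itv /= => /andP[x0 x1].
      by rewrite lee_fin mulrC ler_wpM2l ?powR_ge0// ler_expR lerN2 ltW.
  apply: ge0_subset_integral => //=.
  - by apply/measurable_EFinP; exact: measurable_funTS mh.
  - by move=> x _; rewrite lee_fin h0.
  - by move=> x; rewrite /D /= !in_itv /= andbT => /andP[].
rewrite /Rintegral fine_gt0//; apply/andP; split; [exact: lo|exact: up].
Qed.

(** The endpoints are null. This allows the two-sided [pd] to be replaced by a derivative within a
    box, from which it may differ at the ends. *)
Lemma Lint_eq_oo c d f f' : (forall t, c < t < d -> f t = f' t) ->
  measurable_fun `]c, d[ f -> Lint (cc c d) f = Lint (cc c d) f'.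
Proof.
move=> ff mf.
have E : {in `]c, d[%classic, f =1 f'} by move=> t; rewrite inE /= in_itv /= => /ff.
have mf' : measurable_fun `]c, d[ f' := eq_measurable_fun f E mf.
rewrite /Lint /Rintegral ccE.
rewrite (@integral_itv_bndoo _ c d (EFin \o f) true false); last exact/measurable_EFinP.
rewrite (@integral_itv_bndoo _ c d (EFin \o f') true false); last exact/measurable_EFinP.
by congr fine; apply: eq_integral => t tc /=; rewrite E.
Qed.

(** Fubini on the plane for the extension by zero. Absolute integrability comes from the bounds on
    [f] and [psi] and from the integral of the kernel over [c, s], which is at most (d - c)^(1 -
    g)/(1 - g). *)
Lemma Lint_triangle c d f psi : c <= d ->
  {within `[c, d], continuous f} -> {within `[c, d], continuous psi} ->
  Lint (cc c d) (fun s => f s * Lint (cc c s) (fun x => (s - x) `^ (- g) * psi x)) =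
  Lint (cc c d) (fun x => psi x * Lint (cc x d) (fun s => (s - x) `^ (- g) * f s)).
Proof.
move=> cd cf cpsi.
have mcc := @cc_measurable R; have mcd := mcc c d.
(* Cutting [K] off at negative arguments encodes the triangle x <= s; otherwise [powR] would give 1
   there. *)
pose K : R -> R := (fun t => t `^ (- g)) \_ `[0, +oo[.
pose F : R -> R := f \_ (cc c d).
pose P : R -> R := psi \_ (cc c d).
have mK : measurable_fun setT K.
  apply/(measurable_restrictT _ _).1 => //.
  exact: measurable_funTS (measurable_powR (- g)).
have mF : measurable_fun setT F.
  apply/(measurable_restrictT _ _).1 => //.
  by rewrite ccE; apply: subspace_continuous_measurable_fun.
have mP : measurable_fun setT P.
  apply/(measurable_restrictT _ _).1 => //.
  by rewrite ccE; apply: subspace_continuous_measurable_fun.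
pose h (z : R * R) := F z.1 * (P z.2 * K (z.1 - z.2)).
have mh : measurable_fun setT h.
  apply: measurable_funM; first exact: measurableT_comp.
  apply: measurable_funM; first exact: measurableT_comp.
  apply: measurableT_comp => //; exact: measurable_funB.
have [M1 [M10 hM1]] := within_cc_bounded cf.
have [M2 [M20 hM2]] := within_cc_bounded cpsi.
have hl s : cc c d s ->
    (fun x => h (s, x)) = (fun x => f s * ((s - x) `^ (- g) * psi x)) \_ (cc c s).
  move=> /[dup] sc /andP[cs sd]; apply/funext => x.
  rewrite /h /F /P /K /= !patchE (mem_set sc).
  case: (boolP (x \in cc c s)) => [|/negP xs].
    rewrite inE => /andP[cx xs]; rewrite !mem_set/=; first by rewrite (mulrC (psi x)).
      by rewrite in_itv /= andbT subr_ge0.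
    by rewrite /cc /= cx (le_trans xs).
  case: (boolP (x \in cc c d)) => [|_]; last by rewrite mul0r mulr0.
  rewrite inE => /andP[cx xd]; rewrite memNset ?mulr0//=.
  rewrite in_itv /= andbT subr_ge0 => xs'; apply: xs.
  by rewrite inE /cc /= cx.
have hr x : cc c d x ->
    (fun s => h (s, x)) = (fun s => psi x * ((s - x) `^ (- g) * f s)) \_ (cc x d).
  move=> /[dup] xc /andP[cx xd]; apply/funext => s.
  rewrite /h /F /P /K /= !patchE (mem_set xc).
  case: (boolP (s \in cc x d)) => [|/negP xs].
    rewrite inE => /andP[xs sd]; rewrite !mem_set/=; first by ring.
      by rewrite in_itv /= andbT subr_ge0.
    by rewrite /cc /= sd (le_trans cx).
  case: (boolP (s \in cc c d)) => [|_]; last by rewrite mul0r.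
  rewrite inE => /andP[cs sd]; rewrite memNset ?mulr0//=.
  rewrite in_itv /= andbT subr_ge0 => xs'; apply: xs.
  by rewrite inE /cc /= xs'.
have hl0 s : ~ cc c d s -> (fun x => h (s, x)) = cst 0.
  by move=> ns; apply/funext => x; rewrite /h /F /= patchE memNset// mul0r.
have hr0 x : ~ cc c d x -> (fun s => h (s, x)) = cst 0.
  by move=> ns; apply/funext => s; rewrite /h /P /= patchE memNset// mul0r mulr0.
have inth : (mu \x mu)%E.-integrable setT (EFin \o h).
  apply/integrable12ltyP; first exact/measurable_EFinP.
  pose C := M1 * M2 * ((d - c) `^ (1 - g) / (1 - g)).
  apply: (@le_lt_trans _ _ (\int[mu]_(s in cc c d) C%:E)%E); last first.
    by rewrite integral_cst//= ccE lebesgue_measure_itv /=; case: ifP; rewrite ?mule0 -?EFinM ltry.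
  rewrite [leRHS]integral_mkcond; apply: ge0_le_integral => //=.
  - by move=> s _; apply: integral_ge0 => x _; rewrite lee_fin normr_ge0.
  - apply: (@measurable_fun_fubini_tonelli_F _ _ _ _ _ mu (fun z => `|h z|%:E)) => //.
    by apply/measurable_EFinP; exact: measurableT_comp.
  - by apply/(measurable_restrictT _ _).1.
  move=> s _; rewrite patchE; case: ifPn => [|/negP ns]; last first.
    rewrite (eq_integral (fun=> 0%E)) ?integral0// => x _.
    have := hl0 s; rewrite -[cc c d s]inE => /(_ ns)/(congr1 (@^~ x)) /= ->.
    by rewrite normr0.
  rewrite inE => /[dup] sc /andP[cs sd].
  apply: (@le_trans _ _ (\int[mu]_(x in cc c s) ((M1 * M2)%:E * ((s - x) `^ (- g))%:E))%E).
    rewrite [leRHS]integral_mkcond; apply: ge0_le_integral => //=.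
    - apply/measurable_EFinP; apply: measurableT_comp => //.
      apply: measurableT_comp => //; exact: measurable_pair1.
    - apply/(measurable_restrictT _ _).1; first exact: mcc.
      apply: measurable_funeM.
      apply/measurable_EFinP; exact: measurable_funTS (measurable_kernel_l g s).
    move=> x _; have /(congr1 (@^~ x)) /= -> := hl s sc.
    rewrite !patchE; case: ifP => // [|_]; last by rewrite normr0.
    rewrite inE => /andP[cx xs]; rewrite -EFinM lee_fin !normrM mulrCA mulrC.
    rewrite [`|_ `^ _|]ger0_norm ?powR_ge0// ler_wpM2r ?powR_ge0//.
    by rewrite ler_pM// ?hM1 ?hM2//; apply/andP; split => //; exact: le_trans sd.
  have mcs : measurable (cc c s : set R) := mcc c s.
  rewrite ge0_integralZl//=; last 3 first.
  - apply/measurable_EFinP; exact: measurable_funTS (measurable_kernel_l g s).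
  - by move=> x _; rewrite lee_fin powR_ge0.
  - by rewrite lee_fin mulr_ge0// ltW.
  rewrite kernel_integral_l// -EFinM lee_fin /C.
  apply: ler_wpM2l; first by rewrite mulr_ge0// ltW.
  rewrite ler_pM2r ?invr_gt0//; apply: ge0_ler_powR; first exact: ltW.
  - by rewrite nnegrE subr_ge0.
  - by rewrite nnegrE subr_ge0.
  - by rewrite lerD2r.
have Fub := Fubini inth.
have lhs s : (\int[mu]_x (EFin \o h) (s, x) =
    (((fun s => f s * Lint (cc c s) (fun x => (s - x) `^ (- g) * psi x)) \_ (cc c d)) s)%:E)%E.
  rewrite patchE; case: ifPn => [|/negP ns]; last first.
    have ns' : ~ cc c d s by move=> sc; apply: ns; rewrite inE.
    rewrite integral0_eq; [by []|move=> x _].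
    by have /(congr1 (@^~ x)) hE := hl0 s ns'; rewrite /= hE.
  rewrite inE => /[dup] sc /andP[cs sd].
  have ci : mu.-integrable (cc c s) (EFin \o (fun x => (s - x) `^ (- g) * psi x)).
    exact: (kernel_integrable_l g01 (within_ccS (lexx c) sd cpsi)).
  have e1 : Rintegral mu (cc c s) (fun x => f s * ((s - x) `^ (- g) * psi x)) =
      f s * Rintegral mu (cc c s) (fun x => (s - x) `^ (- g) * psi x).
    by apply: RintegralZl; [exact: mcc|exact: ci].
  rewrite /Lint -e1.
  rewrite /Rintegral fineK; last first.
    apply: integrable_fin_num; first exact: mcc.
    have := kernel_integrable_l g01 (within_ccM (@within_cc_cst _ c s (f s))
      (within_ccS (lexx c) sd cpsi)).
    by congr (_.-integrable _ _); apply/funext => x /=; rewrite mulrCA.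
  rewrite [RHS]integral_EFin_mkcond; apply: eq_integral => x _.
  by have /(congr1 (@^~ x)) /= -> := hl s sc.
have rhs x : (\int[mu]_s (EFin \o h) (s, x) =
    (((fun x => psi x * Lint (cc x d) (fun s => (s - x) `^ (- g) * f s)) \_ (cc c d)) x)%:E)%E.
  rewrite patchE; case: ifPn => [|/negP ns]; last first.
    have ns' : ~ cc c d x by move=> xc; apply: ns; rewrite inE.
    rewrite integral0_eq; [by []|move=> s _].
    by have /(congr1 (@^~ s)) hE := hr0 x ns'; rewrite /= hE.
  rewrite inE => /[dup] xc /andP[cx xd].
  have ci : mu.-integrable (cc x d) (EFin \o (fun s => (s - x) `^ (- g) * f s)).
    exact: (kernel_integrable_r g01 (within_ccS cx (lexx d) cf)).
  have e1 : Rintegral mu (cc x d) (fun s => psi x * ((s - x) `^ (- g) * f s)) =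
      psi x * Rintegral mu (cc x d) (fun s => (s - x) `^ (- g) * f s).
    by apply: RintegralZl; [exact: mcc|exact: ci].
  rewrite /Lint -e1.
  rewrite /Rintegral fineK; last first.
    apply: integrable_fin_num; first exact: mcc.
    have := kernel_integrable_r g01 (within_ccM (@within_cc_cst _ x d (psi x))
      (within_ccS cx (lexx d) cf)).
    by congr (_.-integrable _ _); apply/funext => s /=; rewrite mulrCA.
  rewrite [RHS]integral_EFin_mkcond; apply: eq_integral => s _.
  by have /(congr1 (@^~ s)) /= -> := hr x xc.
have LintE D F' : Lint D F' = fine (\int[mu]_x ((F' \_ D) x)%:E)%E.
  by rewrite /Lint /Rintegral integral_EFin_mkcond.
rewrite [LHS]LintE [RHS]LintE; apply: (congr1 fine).
transitivity (\int[mu]_s \int[mu]_x (EFin \o h) (s, x))%E.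
  by apply: eq_integral => s _; rewrite lhs.
by rewrite Fub; apply: eq_integral => x _; rewrite rhs.
Qed.

End FractionalIntegrals.

Lemma LintZ_integrable (R : realType) (D : set R) (f : R -> R) (e : R) :
  measurable D -> (@lebesgue_measure R).-integrable D (EFin \o f) ->
  Lint D (fun x => e * f x) = e * Lint D f.
Proof. by move=> m i; apply: RintegralZl. Qed.

Lemma LintD_integrable (R : realType) (D : set R) (f1 f2 : R -> R) :
  measurable D -> (@lebesgue_measure R).-integrable D (EFin \o f1) ->
  (@lebesgue_measure R).-integrable D (EFin \o f2) ->
  Lint D (fun x => f1 x + f2 x) = Lint D f1 + Lint D f2.
Proof. by move=> m i1 i2; apply: RintegralD. Qed.

Section FractionalParts.
Variables (R : realType) (g : R).
Hypothesis g01 : 0 < g < 1.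
Implicit Types (c d s t : R) (f psi : R -> R).

Let g1 : 0 < 1 - g. Proof. by case/andP: g01; rewrite subr_gt0. Qed.

Lemma Lint_kernel_l_lin c s f1 f2 (e : R) :
  {within `[c, s], continuous f1} -> {within `[c, s], continuous f2} ->
  Lint (cc c s) (fun x => (s - x) `^ (- g) * (f1 x + e * f2 x)) =
  Lint (cc c s) (fun x => (s - x) `^ (- g) * f1 x) +
  e * Lint (cc c s) (fun x => (s - x) `^ (- g) * f2 x).
Proof.
move=> c1 c2; have m := @cc_measurable R c s.
have i1 := kernel_integrable_l g01 c1; have i2 := kernel_integrable_l g01 c2.
have i3 := kernel_integrable_l g01 (within_ccM (@within_cc_cst R c s e) c2).
have E : EFin \o (fun x => (s - x) `^ (- g) * (e * f2 x)) =
    EFin \o (fun x => e * ((s - x) `^ (- g) * f2 x)).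
  by apply/funext => x /=; rewrite mulrCA.
rewrite E in i3.
rewrite -(LintZ_integrable e m i2) -(LintD_integrable m i1 i3).
by apply: Lint_eq => x _; rewrite mulrDr [_ * (e * _)]mulrCA.
Qed.

Lemma Lint_kernel_rZ s d f (e : R) : {within `[s, d], continuous f} ->
  Lint (cc s d) (fun x => (x - s) `^ (- g) * (e * f x)) =
  e * Lint (cc s d) (fun x => (x - s) `^ (- g) * f x).
Proof.
move=> cf; have m := @cc_measurable R s d.
have i1 := kernel_integrable_r g01 cf.
rewrite -(LintZ_integrable e m i1).
by apply: Lint_eq => x _; rewrite mulrCA.
Qed.

(** The last hypothesis is the defining relation of the Riemann-Liouville derivative on a line.
    Fubini puts the kernel on [f], giving [J]; the minus sign in its derivative - Gamma V cancels
    that of integration by parts, and [phi] kills both boundary terms. *)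
Lemma fractional_parts c d (f phi psi V : R -> R) : c <= d ->
  {within `[c, d], continuous f} -> {within `[c, d], continuous V} ->
  primitive_on c d phi psi -> {within `[c, d], continuous psi} ->
  phi c = 0 -> phi d = 0 ->
  (forall t, c <= t <= d -> deriv_within (cc c d)
     (fun t => Lint (cc t d) (fun s => (s - t) `^ (- g) * f s)) t
     (- Gamma (1 - g) * V t)) ->
  Lint (cc c d) (fun s => f s *
     ((Gamma (1 - g))^-1 * Lint (cc c s) (fun x => (s - x) `^ (- g) * psi x))) =
  Lint (cc c d) (fun s => V s * phi s).
Proof.
move=> cd cf cV pphi cpsi phic phid dJ.
have G0 : Gamma (1 - g) != 0 by rewrite gt_eqF// Gamma_gt0.
set Gi := (Gamma (1 - g))^-1.
have GiE : Gi * - Gamma (1 - g) = - 1 by rewrite mulrN mulVf.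
clearbody Gi.
set J := fun t => Lint (cc t d) (fun s => (s - t) `^ (- g) * f s) in dJ.
have cGf : {within `[c, d], continuous (fun s => Gi * f s)}.
  by apply: within_ccM => //; exact: within_cc_cst.
transitivity (Lint (cc c d) (fun s => (Gi * f s) *
    Lint (cc c s) (fun x => (s - x) `^ (- g) * psi x))).
  by apply: Lint_eq => s _; rewrite mulrA (mulrC _ Gi).
rewrite (Lint_triangle g01 cd cGf cpsi).
transitivity (Lint (cc c d) (fun x => psi x * (Gi * J x))).
  apply: Lint_eq => x /andP[cx xd]; rewrite Lint_kernel_rZ//.
  exact: within_ccS cx (lexx d) cf.
have pJ : primitive_on c d (fun x => Gi * J x) (fun x => - V x).
  apply: (@primitive_eq _ _ _ _ (fun x => Gi * (- Gamma (1 - g) * V x))).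
    by move=> t _; rewrite mulrA GiE mulN1r.
  exact/primitiveZ/deriv_within_primitive.
have cVN := within_ccN cV.
have : Lint (cc c d) (fun s => psi s * (Gi * J s)) +
    Lint (cc c d) (fun s => phi s * - V s) = 0.
  transitivity (phi d * (Gi * J d) - phi c * (Gi * J c)); first exact: Lint_parts.
  have e0 (x y : R) : 0 * x - 0 * y = 0 by rewrite !mul0r subrr.
  by rewrite phic phid e0.
have -> : Lint (cc c d) (fun s => phi s * - V s) = - Lint (cc c d) (fun s => V s * phi s).
  rewrite -[RHS]mulN1r -LintZ; last by apply: within_ccM => //; case: pphi.
  by apply: Lint_eq => s _; rewrite mulN1r mulrN mulrC.
by move/eqP; rewrite subr_eq0 => /eqP.
Qed.

(** The Beta value B(2, 1 - g) = 1/((1 - g)(2 - g)), left in the form in which the primitive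
    delivers it. *)
Definition kappa : R := (1 - g)^-1 - (2 - g)^-1.

(** Writing x - c0 = (s - c0) - (s - x) splits the integrand into two pure powers of s - x, which
    [Psi] integrates. Below [c0] the truncated power vanishes, so the integral effectively starts at
    the knot. *)
Lemma Lint_kernel_tpow1 c c0 s : c <= c0 -> c <= s ->
  Lint (cc c s) (fun x => (s - x) `^ (- g) * tpow 1 (x - c0)) =
  kappa * tpow (2 - g) (s - c0).
Proof.
move=> cc0 cs; have g2 : 0 < 2 - g by move: g1; lra.
have [sc0|c0s] := leP s c0.
  rewrite [tpow (2 - g) _]tpow_le ?gt_eqF// ?subr_le0// mulr0.
  rewrite (@Lint_eq _ _ _ (fun=> 0)); first by rewrite Lint_cst// mul0r.
  move=> x /andP[cx xs]; rewrite tpow_le ?mulr0 ?oner_neq0//.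
  by rewrite subr_le0 (le_trans xs).
have -> : Lint (cc c s) (fun x => (s - x) `^ (- g) * tpow 1 (x - c0)) =
    Lint (cc c0 s) (fun x => (s - x) `^ (- g) * tpow 1 (x - c0)).
  have -> : cc c0 s = cc c s `&` cc c0 s.
    apply/seteqP; split => [x|x []//] /andP[h1 h2].
    by split; rewrite /cc /= ?h1 h2 ?(le_trans cc0 h1).
  rewrite [RHS]/Lint Rintegral_mkcondr; apply: Lint_eq => x /andP[cx xs].
  rewrite patchE; case: ifPn => // xc0; rewrite tpow_le ?mulr0 ?oner_neq0//.
  rewrite leNgt; apply: contra xc0; rewrite subr_gt0 => h.
  by rewrite inE /cc /= xs ltW.
pose Psi x := (s - c0) * (- (1 - g)^-1 * tpow (1 - g) (s - x)) +
              (2 - g)^-1 * tpow (2 - g) (s - x).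
have pPsi : primitive_on c0 s Psi (fun x => (s - x) `^ (- g) * tpow 1 (x - c0)).
  apply: (@primitive_eq _ _ _ _ (fun x =>
    (s - c0) * (- (1 - g)^-1 * - ((1 - g) * (s - x) `^ (1 - g - 1))) +
    (2 - g)^-1 * - ((2 - g) * (s - x) `^ (2 - g - 1)))).
    move=> x /andP[c0x xs]; have xs0 : 0 < s - x by rewrite subr_gt0.
    rewrite tpow1 max_l ?subr_ge0 ?ltW//.
    have -> : 2 - g - 1 = 1 - g by ring.
    rewrite -(mulr_powRB1 (ltW xs0) g1) (_ : 1 - g - 1 = - g); last by ring.
    set X := (s - x) `^ (- g).
    transitivity ((s - c0) * X * ((1 - g)^-1 * (1 - g)) -
                  (s - x) * X * ((2 - g)^-1 * (2 - g))); first by ring.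
    by rewrite !mulVf ?gt_eqF//; ring.
  apply: primitiveD; apply: primitiveZ; first apply: primitiveZ.
    split.
      by apply: within_cc_cont; exact: continuous_reflect (tpow_cont g1).
    move=> t /andP[_ ts]; apply: is_derive_reflect; apply: tpow_derive_pos.
    by rewrite subr_gt0.
  split.
    by apply: within_cc_cont; exact: continuous_reflect (tpow_cont g2).
  move=> t /andP[_ ts]; apply: is_derive_reflect; apply: tpow_derive_pos.
  by rewrite subr_gt0.
have ct1 : continuous (fun x : R => tpow 1 (x - c0)).
  exact: (@continuous_translate R (tpow 1) c0 (tpow_cont (@ltr01 R))).
rewrite /Lint /Rintegral ccE.
rewrite (@integral_itv_bndoo _ c0 s _ true false); last first.
  apply/measurable_EFinP; apply: measurable_funM.
    exact: measurable_funTS (measurable_kernel_l g s).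
  exact: measurable_funTS (continuous_measurable_fun ct1).
rewrite (integral_primitive_oo c0s pPsi) /=.
- rewrite /Psi !subrr ![tpow _ 0]tpow_le ?gt_eqF//.
  have sc0 : 0 <= s - c0 by rewrite subr_ge0 ltW.
  rewrite !tpow_ge// /kappa.
  have -> : (s - c0) `^ (2 - g) = (s - c0) * (s - c0) `^ (1 - g).
    by rewrite -[LHS](mulr_powRB1 sc0 g2); congr (_ * _ `^ _); ring.
  ring.
- move=> t /andP[_ ts]; apply: continuousM; last exact: ct1.
  have st : 0 < s - t by rewrite subr_gt0.
  have [h _] := is_derive_reflect (is_derive1_powR (- g) st).
  by apply: differentiable_continuous; apply/derivable1_diffP.
- by move=> t _; rewrite mulr_ge0 ?powR_ge0 ?tpow_ge0.
Qed.

End FractionalParts.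

(** * Splines as test functions *)

Section Splines.
Variable R : realType.
Implicit Types (r s c w : R) (q : seq (R * R)).

(** A list of pairs (coefficient, knot). The exponent is kept apart from the list because
    differentiation and fractional integration change only the exponent, up to a factor. *)
Definition spline r q s := \sum_(x <- q) x.1 * tpow r (s - x.2).

Lemma spline_cons r x q s :
  spline r (x :: q) s = x.1 * tpow r (s - x.2) + spline r q s.
Proof. by rewrite /spline big_cons. Qed.

Lemma spline_nil r s : spline r [::] s = 0.
Proof. by rewrite /spline big_nil. Qed.

Lemma spline_cont r q : 0 < r -> continuous (spline r q).
Proof.
move=> r0; elim: q => [|x q IH] s.
  by rewrite (_ : spline r [::] = fun=> 0); [exact: cst_continuous|
    apply/funext => y; rewrite spline_nil].
rewrite (_ : spline r (x :: q) = fun y => x.1 * tpow r (y - x.2) + spline r q y); last first.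
  by apply/funext => y; rewrite spline_cons.
apply: cvgD; last exact: IH.
apply: cvgM; first exact: cvg_cst.
exact: (@continuous_translate R (tpow r) x.2 (tpow_cont r0) s).
Qed.

Lemma spline_derive r q s : 1 < r ->
  is_derive s (1 : R) (spline r q) (r * spline (r - 1) q s).
Proof.
move=> r1; elim: q => [|x q IH].
  rewrite spline_nil mulr0 (_ : spline r [::] = fun=> 0); first exact: is_derive_cst.
  by apply/funext => y; rewrite spline_nil.
rewrite (_ : spline r (x :: q) =
   x.1 *: (fun y => tpow r (y - x.2)) + spline r q); last first.
  by apply/funext => y; rewrite spline_cons.
have h := is_derive_translate (tpow_derive (s - x.2) r1).
apply: is_derive_eq (is_deriveD (is_deriveZ x.1 h) IH) _.
by rewrite spline_cons mulrDr mulrCA.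
Qed.

Lemma Lint_kernel_spline g c q s : 0 < g < 1 -> c <= s ->
  (forall x, x \in q -> c <= x.2) ->
  Lint (cc c s) (fun x => (s - x) `^ (- g) * spline 1 q x) =
  kappa g * spline (2 - g) q s.
Proof.
move=> g01 cs; elim: q => [|x q IH] hq.
  rewrite spline_nil mulr0 (@Lint_eq _ _ _ (fun=> 0)); first by rewrite Lint_cst// mul0r.
  by move=> y _; rewrite spline_nil mulr0.
rewrite (@Lint_eq _ _ _ (fun y => (s - y) `^ (- g) * (spline 1 q y + x.1 * tpow 1 (y - x.2)))).
  rewrite Lint_kernel_l_lin//; last 2 first.
  - exact/within_cc_cont/spline_cont.
  - exact: within_cc_cont (@continuous_translate R (tpow 1) x.2 (tpow_cont (@ltr01 R))).
  rewrite IH; last by move=> y yq; apply: hq; rewrite inE yq orbT.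
  rewrite Lint_kernel_tpow1//; last by apply: hq; rewrite inE eqxx.
  by rewrite spline_cons; ring.
by move=> y _; congr (_ * _); rewrite spline_cons addrC.
Qed.

(* Third differences: the quadratic B-spline supported on [c, c + 3w]. *)
Definition bspline c w : seq (R * R) :=
  [:: (1, c); (- 3, c + w); (3, c + 2 * w); (- 1, c + 3 * w)].

Lemma bsplineE r c w s : spline r (bspline c w) s =
  tpow r (s - c) - 3 * tpow r (s - (c + w)) + 3 * tpow r (s - (c + 2 * w)) -
  tpow r (s - (c + 3 * w)).
Proof. by rewrite !spline_cons spline_nil /=; ring. Qed.

Lemma bspline_left r c w s : 0 < r -> 0 < w -> s <= c ->
  spline r (bspline c w) s = 0.
Proof.
move=> r0 w0 sc; rewrite bsplineE !tpow_le ?gt_eqF//; [ring|lra..].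
Qed.

(** Between consecutive knots this is a polynomial inequality, settled by cases on signs; beyond the
    last knot it is a third difference of a quadratic, hence zero. *)
Lemma bspline2 c w s : 0 < w -> 0 <= spline 2 (bspline c w) s /\
  (c + 3 * w <= s -> spline 2 (bspline c w) s = 0).
Proof.
move=> w0; rewrite bsplineE !tpow2.
have h x : Num.max x 0 = if x <= 0 then 0 else x :> R.
  by case: (leP x 0).
rewrite !h; split.
  by do ! case: ifPn => ?; nra.
by move=> ?; do ! case: ifPn => ?; nra.
Qed.

Lemma Lint_bspline c w d e : 0 < w -> d <= c -> c + 3 * w <= e ->
  0 < Lint (cc d e) (spline 2 (bspline c w)).
Proof.
move=> w0 dc ce; have de : d <= e by lra.
have c2 : {within `[d, e], continuous (spline 2 (bspline c w))}.
  exact/within_cc_cont/spline_cont.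
have p3 : primitive_on d e (fun s => 3^-1 * spline 3 (bspline c w) s)
    (spline 2 (bspline c w)).
  apply: (@primitive_eq _ _ _ _ (fun s => 3^-1 * (3 * spline (3 - 1) (bspline c w) s))).
    move=> t _; rewrite mulrA mulVf// mul1r; congr (spline _ _ _); ring.
  apply: primitiveZ; split; first by apply/within_cc_cont/spline_cont.
  by move=> t _; apply: spline_derive; lra.
rewrite (primitive_Lint de p3 c2) (@bspline_left 3 c w d)// mulr0 subr0.
have t3 (x : R) : 0 <= x -> tpow 3 x = x ^+ 3 by move=> x0; rewrite tpow_ge// powR_mulrn.
rewrite bsplineE !t3; [|lra..].
(* The third difference of the cube with step w is 3! w^3. *)
rewrite (_ : _ - _ = 6 * w ^+ 3); last by ring.
by rewrite !mulr_gt0 ?invr_gt0// exprn_gt0.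
Qed.

Definition test_fun c d : set (R -> R) :=
  [set phi | exists c0 w, [/\ 0 < w, c <= c0, c0 + 3 * w <= d &
     phi = spline 2 (bspline c0 w)]].

Lemma test_fun_fundamental c d (f : R -> R) : c < d ->
  {within `[c, d], continuous f} ->
  (forall phi, test_fun c d phi -> Lint (cc c d) (fun y => phi y * f y) = 0) ->
  forall y, c <= y <= d -> f y = 0.
Proof.
move=> cd.
(* One-sided statement; applied to [f] and to [- f] it gives the claim. *)
have pos (h : R -> R) : {within `[c, d], continuous h} ->
    (forall phi, test_fun c d phi -> Lint (cc c d) (fun y => phi y * h y) = 0) ->
    forall y, c <= y <= d -> h y <= 0.
  move=> ch hI y yc; rewrite leNgt; apply/negP => hy.
  have /within_ccP/(_ y yc _ (divr_gt0 hy (ltr0Sn _ 1)))[del [del0 hd]] := ch.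
  (* The support has length 3w, at most a quarter of [del], so it stays where h > h y / 2; and 6w <=
     d - c leaves room for it on one side of y. *)
  pose w := Num.min del (d - c) / 12.
  have m0 : 0 < Num.min del (d - c) by rewrite lt_min del0 subr_gt0.
  have w0 : 0 < w by rewrite divr_gt0.
  have w1 : 12 * w <= del by rewrite /w mulrC divfK// ge_min lexx.
  have w2 : 12 * w <= d - c by rewrite /w mulrC divfK// ge_min lexx orbT.
  (* The support lies to the right of [y] if it fits into [c, d], and to the left otherwise. *)
  have [c0 [h1 h2 h3 h4]] : exists c0, [/\ c <= c0, c0 + 3 * w <= d,
      y - 3 * w <= c0 & c0 <= y].
    have [yd|yd] := leP (y + 3 * w) d.
      by exists y; split => //; [by case/andP: yc|lra].
    by exists (y - 3 * w); case/andP: yc => ? ?; split; lra.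
  pose phi := spline 2 (bspline c0 w).
  have T : test_fun c d phi by exists c0, w; split.
  have cphi : {within `[c, d], continuous phi} by exact/within_cc_cont/spline_cont.
  have := hI phi T; apply/eqP; rewrite gt_eqF//.
  apply: (@lt_le_trans _ _ (Lint (cc c d) (fun s => h y / 2 * phi s))).
    by rewrite LintZ// mulr_gt0 ?divr_gt0// Lint_bspline.
  apply: Lint_le; [|exact: within_ccM|].
    by apply: within_ccM => //; exact: within_cc_cst.
  move=> s sc; have [p0 pr] := bspline2 c0 s w0; rewrite mulrC.
  have [sl|sl] := leP s c0; first by rewrite /phi bspline_left// !mul0r.
  have [sr|sr] := leP (c0 + 3 * w) s; first by rewrite /phi pr// !mul0r.
  apply: ler_wpM2l => //.
  have : `|h s - h y| < h y / 2 by apply: hd => //; rewrite ltr_norml; lra.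
  by rewrite ltr_norml => /andP[? ?]; lra.
move=> cf hI y yc; apply/eqP; rewrite eq_le; apply/andP; split; first exact: (pos f).
rewrite -oppr_le0; apply: (pos (fun y => - f y)) => //; first exact: within_ccN.
move=> phi T; have [c0 [w [w0 h1 h2 phiE]]] := T.
have cphi : {within `[c, d], continuous phi}.
  by rewrite phiE; exact/within_cc_cont/spline_cont.
rewrite (@Lint_eq _ _ _ (fun y => -1 * (phi y * f y))).
  by rewrite LintZ ?hI ?mulr0//; exact: within_ccM.
by move=> s _; rewrite mulN1r mulrN.
Qed.

End Splines.

(** * Partial derivatives and Caputo derivatives on boxes *)

Section PartialDerivatives.
Variables (R : realType) (I : finType).
Implicit Types (S : set (I -> R)) (F G : (I -> R) -> R) (p : I -> R) (k : I).

Lemma pderiv_within_is_derive S F p k (v : R) :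
  (exists e : R, 0 < e /\ forall s, `|s - p k| < e -> S (upd p k s)) ->
  pderiv_within S F p k v ->
  is_derive (p k) (1 : R) (fun s => F (upd p k s)) v.
Proof. by move=> hS; apply: deriv_within_is_derive. Qed.

Lemma is_derive_derive1 (f : R -> R) t (v : R) : is_derive t (1 : R) f v -> derive1 f t = v.
Proof. by move=> [_ <-]; rewrite derive1E. Qed.

Lemma deriv_within_lin (T : set R) (f f' : R -> R) t (v v' e : R) :
  deriv_within T f t v -> deriv_within T f' t v' ->
  deriv_within T (fun s => f s + e * f' s) t (v + e * v').
Proof.
move=> h h' eps eps0.
have e1 : 0 < `|e| + 1 by rewrite ltr_wpDl.
have [d [d0 hd]] := h _ (divr_gt0 eps0 (ltr0Sn _ 1)).
have [d' [d'0 hd']] := h' _ (divr_gt0 (divr_gt0 eps0 (ltr0Sn _ 1)) e1).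
exists (Num.min d d'); split; first by rewrite lt_min d0.
move=> k k0; rewrite lt_min => /andP[kd kd'] Tk.
have h1 := hd k k0 kd Tk; have h2 := hd' k k0 kd' Tk.
set A := (f (t + k) - f t) / k - v in h1.
set B := (f' (t + k) - f' t) / k - v' in h2.
rewrite (_ : _ - _ = A + e * B); last by rewrite /A /B; ring.
apply: le_lt_trans (ler_normD _ _) _; rewrite normrM.
have : `|e| * `|B| <= (`|e| + 1) * `|B| by rewrite ler_wpM2r// lerDl.
have : (`|e| + 1) * `|B| < eps / 2 by rewrite mulrC -ltr_pdivlMr.
lra.
Qed.

Lemma deriv_within_uniq c d (f : R -> R) t (v v' : R) : c < d -> c <= t <= d ->
  deriv_within (cc c d) f t v -> deriv_within (cc c d) f t v' -> v = v'.
Proof.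
move=> cd tc h h'; apply/eqP; rewrite -subr_eq0 -normr_le0 leNgt; apply/negP => v0.
have [e [e0 he]] := h _ (divr_gt0 v0 (ltr0Sn _ 1)).
have [e' [e'0 he']] := h' _ (divr_gt0 v0 (ltr0Sn _ 1)).
(* At most half the interval, so t + w or t - w lies in [c, d] even when t is an end; and small
   enough for both difference quotients. *)
pose w := Num.min (Num.min e e') (d - c) / 2.
have m0 : 0 < Num.min (Num.min e e') (d - c) by rewrite !lt_min e0 e'0 subr_gt0.
have w0 : 0 < w by rewrite divr_gt0.
have wm : w < Num.min (Num.min e e') (d - c).
  by rewrite /w ltr_pdivrMr// ltr_pMr// ltr1n.
have w2 : 2 * w = Num.min (Num.min e e') (d - c) by rewrite /w mulrC divfK.
have w3 : 2 * w <= d - c by rewrite w2 ge_min lexx orbT.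
move: wm; rewrite !lt_min => /andP[/andP[we we'] _].
have [k [k0 ka kc]] : exists k : R, [/\ k != 0, `|k| = w & cc c d (t + k)].
  have [td|td] := leP (t + w) d.
    exists w; split; rewrite ?gt_eqF ?gtr0_norm// /cc /=.
    by case/andP: tc => ? ?; apply/andP; split => //; lra.
  exists (- w); split; rewrite ?oppr_eq0 ?gt_eqF ?normrN ?gtr0_norm// /cc /=.
  by case/andP: tc => ? ?; apply/andP; split; lra.
have h1 := he k k0; rewrite ka in h1; have := h1 we kc.
have h2 := he' k k0; rewrite ka in h2; have := h2 we' kc.
set q := _ / _ => a1 a2.
have : `|v - v'| <= `|q - v'| + `|q - v|.
  rewrite (_ : v - v' = (q - v') - (q - v)); last by ring.
  exact: ler_normB.
lra.
Qed.

Lemma C1on_lin S F G (e : R) : C1on S F -> C1on S G ->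
  C1on S (fun p => F p + e * G p).
Proof.
move=> [cF dF] [cG dG]; split.
  by apply: cont_onD => //; apply: cont_onM => //; exact: cont_on_cst.
move=> k; have [DF [hF cDF]] := dF k; have [DG [hG cDG]] := dG k.
exists (fun p => DF p + e * DG p); split.
  by move=> p Sp; apply: deriv_within_lin; [exact: hF|exact: hG].
by apply: cont_onD => //; apply: cont_onM => //; exact: cont_on_cst.
Qed.

Lemma C1on_eq S F G : (forall p, S p -> F p = G p) -> C1on S F -> C1on S G.
Proof.
move=> FG [cF dF]; split; first exact: cont_on_eq cF.
move=> k; have [DF [hF cDF]] := dF k; exists DF; split => // p Sp e e0.
have [d [d0 hd]] := hF p Sp e e0; exists d; split => // y y0 yd Sy.
by have := hd y y0 yd Sy; rewrite !upd_id !FG.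
Qed.

Lemma C1on_cst S (c : R) : C1on S (fun=> c).
Proof.
split; first exact: cont_on_cst.
move=> k; exists (fun=> 0); split; last exact: cont_on_cst.
move=> p Sp e e0; exists 1; split => // y _ _ _.
by rewrite subrr mul0r subrr normr0.
Qed.

Lemma cont_on_coord S k (f : R -> R) : continuous f -> cont_on S (fun p => f (p k)).
Proof.
move=> cf u _ e e0.
have /cvgrPdist_lt/(_ e e0)/nbhs_ballP[d /= d0 hd] := cf (u k).
by exists d; split => // v _ uv; rewrite distrC; apply: hd; rewrite /ball /= distrC.
Qed.

Definition prodf (phi : I -> R -> R) p := \prod_k phi k (p k).

Definition prodf' (phi : I -> R -> R) k p := \prod_(i | i != k) phi i (p i).

Lemma prodfE phi k p : prodf phi p = phi k (p k) * prodf' phi k p.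
Proof. by rewrite /prodf (bigD1 k). Qed.

Lemma prodf'_upd phi k p x : prodf' phi k (upd p k x) = prodf' phi k p.
Proof. by apply: eq_bigr => i ik; rewrite upd_neq. Qed.

Lemma prodf_upd phi k p x : prodf phi (upd p k x) = phi k x * prodf' phi k p.
Proof. by rewrite (prodfE phi k) upd_same prodf'_upd. Qed.

Lemma cont_on_prodf S phi : (forall k, continuous (phi k)) -> cont_on S (prodf phi).
Proof. by move=> c; apply: cont_on_prod => k _; exact: cont_on_coord. Qed.

Lemma cont_on_prodf' S phi k : (forall i, continuous (phi i)) ->
  cont_on S (prodf' phi k).
Proof. by move=> c; apply: cont_on_prod => i _; exact: cont_on_coord. Qed.

Lemma prodf_pderiv S phi k (v : R -> R) :
  (forall x, is_derive x (1 : R) (phi k) (v x)) ->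
  forall p, pderiv_within S (prodf phi) p k (v (p k) * prodf' phi k p).
Proof.
move=> dphi p; apply: is_derive_deriv_within.
rewrite (_ : (fun s => _) = prodf' phi k p *: phi k); last first.
  by apply/funext => s; rewrite prodf_upd mulrC.
by apply: is_derive_eq; rewrite mulrC.
Qed.

Lemma C1on_prodf S phi (dphi : I -> R -> R) :
  (forall k x, is_derive x (1 : R) (phi k) (dphi k x)) ->
  (forall k, continuous (dphi k)) -> C1on S (prodf phi).
Proof.
move=> hd cd.
have cphi k : continuous (phi k).
  move=> x; apply: differentiable_continuous; apply/derivable1_diffP.
  by have [] := hd k x.
split; first exact: cont_on_prodf.
move=> k; exists (fun p => dphi k (p k) * prodf' phi k p); split.
  by move=> p _; apply: prodf_pderiv.
by apply: cont_onM; [exact: cont_on_coord|exact: cont_on_prodf'].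
Qed.

End PartialDerivatives.

Section CaputoOnBoxes.
Variables (R : realType) (I : finType) (l h : I -> R) (g : R).
Hypothesis g01 : 0 < g < 1.
Implicit Types (F G : (I -> R) -> R) (p : I -> R) (k : I).
Local Notation B := (box l h).

Lemma pd_box F p k (v : R) : B p -> l k < p k < h k ->
  pderiv_within B F p k v -> pd F k p = v.
Proof.
move=> Bp /andP[lp ph] hF; apply: is_derive_derive1.
apply: pderiv_within_is_derive hF; exists (Num.min (p k - l k) (h k - p k)).
split; first by rewrite lt_min !subr_gt0 lp.
move=> s; rewrite lt_min => /andP[]; rewrite !ltr_norml => /andP[? ?] /andP[? ?].
by apply: box_upd => //; apply/andP; split; lra.
Qed.

(** Replaces [pd] by any derivative within the box. For l k < t < p k the coordinate is interior, so
    both derivatives agree there even if other coordinates lie on faces; the ends of the integral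
    are null. *)
Lemma caputoE F (D : (I -> R) -> R) k p : B p ->
  (forall q, B q -> pderiv_within B F q k (D q)) -> cont_on B D ->
  caputo (l k) g F k p = (Gamma (1 - g))^-1 *
    Lint (cc (l k) (p k)) (fun x => (p k - x) `^ (- g) * D (upd p k x)).
Proof.
move=> Bp hF cD; congr (_ * _); apply/esym; apply: Lint_eq_oo.
  move=> t /andP[lt tp]; congr (_ * _); apply/esym.
  have [lk kh] : l k <= p k /\ p k <= h k by have /andP[] := Bp k.
  have But : B (upd p k t) by apply: box_upd => //; apply/andP; split; lra.
  apply: pd_box => //; last exact: hF.
  by rewrite upd_same lt /=; exact: lt_le_trans kh.
have cs := cont_on_slice (k := k) cD Bp.
apply: measurable_funM; first exact: measurable_funTS (measurable_kernel_l g (p k)).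
apply: (@measurable_funS _ _ _ _ `[l k, h k]) => //.
  move=> x; rewrite /= !in_itv /= => /andP[lx xp].
  by have /andP[_ ph] := Bp k; rewrite ltW// (le_trans (ltW xp)).
exact: subspace_continuous_measurable_fun.
Qed.

Lemma caputo_lin F G (e : R) k p : C1on B F -> C1on B G -> B p ->
  caputo (l k) g (fun q => F q + e * G q) k p =
  caputo (l k) g F k p + e * caputo (l k) g G k p.
Proof.
move=> [_ /(_ k)[DF [hF cF]]] [_ /(_ k)[DG [hG cG]]] Bp.
rewrite (caputoE Bp hF cF) (caputoE Bp hG cG).
rewrite (@caputoE _ (fun q => DF q + e * DG q) k p Bp); last 2 first.
- by move=> q Bq; apply: deriv_within_lin; [exact: hF|exact: hG].
- by apply: cont_onD => //; apply: cont_onM => //; exact: cont_on_cst.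
have lk := lexx (l k); have /andP[_ ph] := Bp k.
rewrite (Lint_kernel_l_lin g01 e (within_ccS lk ph (cont_on_slice (k := k) cF Bp))
  (within_ccS lk ph (cont_on_slice (k := k) cG Bp))).
by rewrite mulrDr mulrCA.
Qed.

Lemma caputo0 c k p : caputo c g (fun=> 0) k p = 0.
Proof.
rewrite /caputo (@Lint_eq _ _ _ (fun=> 0)).
  by rewrite /Lint Rintegral_cst ?mul0r ?mulr0//; exact: cc_measurable.
by move=> s _; rewrite /pd derive1_cst mulr0.
Qed.

End CaputoOnBoxes.

(** * Products of splines as variations *)

Section ProductTestFunctions.
Variables (R : realType) (I : finType) (l h : I -> R).
Hypothesis lh : forall k, l k < h k.
Variables (phi : I -> R -> R) (q : I -> seq (R * R)).
Hypotheses (phiE : forall k, phi k = spline 2 (q k))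
  (hq : forall k x, x \in q k -> l k <= x.2)
  (phil : forall k, phi k (l k) = 0) (phih : forall k, phi k (h k) = 0).
Implicit Types (G V : (I -> R) -> R) (p : I -> R) (k : I).
Local Notation B := (box l h).

Lemma spline2_derive k x : is_derive x (1 : R) (phi k) (2 * spline (2 - 1) (q k) x).
Proof. by rewrite phiE; apply: spline_derive; lra. Qed.

Lemma spline2_cont k : continuous (phi k).
Proof. by rewrite phiE; exact: spline_cont. Qed.

Lemma spline2_derive_cont k : continuous (fun x => 2 * spline (2 - 1) (q k) x).
Proof.
move=> x; apply: cvgM; first exact: cvg_cst.
by apply: spline_cont; lra.
Qed.

Lemma prodf_C1 : C1on B (prodf phi).
Proof. exact: C1on_prodf spline2_derive spline2_derive_cont. Qed.

Lemma prodf_boundary p k : p k = l k \/ p k = h k -> prodf phi p = 0.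
Proof. by rewrite (prodfE phi k) => -[]->; rewrite ?phil ?phih mul0r. Qed.

Lemma caputo_prodf g k p : 0 < g < 1 -> B p ->
  caputo (l k) g (prodf phi) k p = (Gamma (1 - g))^-1 *
    Lint (cc (l k) (p k)) (fun x => (p k - x) `^ (- g) *
      (2 * spline (2 - 1) (q k) x * prodf' phi k p)).
Proof.
move=> g01 Bp.
rewrite (@caputoE _ _ l h _ _ (fun q0 => 2 * spline (2 - 1) (q k) (q0 k) * prodf' phi k q0))//.
- by congr (_ * _); apply: Lint_eq => x _; rewrite prodf'_upd upd_same.
- by move=> q0 _; exact: prodf_pderiv (spline2_derive k) q0.
- apply: cont_onM; first exact: cont_on_coord (@spline2_derive_cont k).
  by apply: cont_on_prodf' => i; exact: spline2_cont.
Qed.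

(** The Caputo derivative of the product is again a product: in coordinate [k] the quadratic spline
    becomes a multiple of the spline of exponent 2 - g on the same knots, and the other factors
    stay. Its derivative has exponent 1 - g > 0 and is therefore continuous. *)
Lemma caputo_prodf_C1 g k : 0 < g < 1 -> C1on B (caputo (l k) g (prodf phi) k).
Proof.
move=> g01; have g2 : 0 < 2 - g - 1 by case/andP: g01 => ? ?; lra.
(* The 2 comes from differentiating the square, [kappa g] from the kernel. *)
pose K := (Gamma (1 - g))^-1 * (2 * kappa g).
pose psi i := if i == k then fun x => K * spline (2 - g) (q k) x else phi i.
pose dpsi i := if i == k then fun x => K * ((2 - g) * spline (2 - g - 1) (q k) x)
               else fun x => 2 * spline (2 - 1) (q i) x.
apply: (@C1on_eq _ _ _ (prodf psi)); last first.
  apply: (@C1on_prodf _ _ _ _ dpsi) => i.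
    rewrite /psi /dpsi; case: eqP => _ x; last exact: spline2_derive.
    by apply: is_deriveZ; apply: spline_derive; lra.
  rewrite /dpsi; case: eqP => _; last exact: spline2_derive_cont.
  move=> x; apply: cvgM; first exact: cvg_cst.
  by apply: cvgM; [exact: cvg_cst|exact: spline_cont].
move=> p Bp; rewrite caputo_prodf// (prodfE psi k) {1}/psi eqxx /=.
have -> : prodf' psi k p = prodf' phi k p.
  by apply: eq_bigr => i ik; rewrite /psi (negbTE ik).
have [lp ph] : l k <= p k /\ p k <= h k by have /andP[] := Bp k.
have e1 : 2 - 1 = 1 :> R by ring.
pose c := 2 * prodf' phi k p.
rewrite (@Lint_eq _ _ _ (fun x => (p k - x) `^ (- g) * (0 + c * spline 1 (q k) x))).
  rewrite (Lint_kernel_l_lin g01 c (@within_cc_cst _ _ _ 0)); last first.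
    exact/within_cc_cont/spline_cont.
  rewrite (Lint_kernel_spline g01 lp (@hq k)).
  rewrite (@Lint_eq _ _ _ (fun=> 0)); last by move=> x _; rewrite mulr0.
  by rewrite Lint_cst// mul0r add0r /c /K; ring.
by move=> x _; rewrite e1 /c; congr (_ * _); ring.
Qed.

(** With the integral over [k] innermost, the remaining factors form the constant [c], and
    [fractional_parts] applies on each line parallel to the axis [k]. *)
Lemma mint_fractional_parts g s k G V : 0 < g < 1 -> k \in s ->
  cont_on B G -> cont_on B V ->
  (forall p, B p -> is_RLright B (h k) g G k p (V p)) ->
  forall p, B p ->
  mint l h s (fun p => G p * caputo (l k) g (prodf phi) k p) p =
  mint l h s (fun p => V p * prodf phi p) p.
Proof.
move=> g01 ks cG cV hRL p Bp.
have cphi : cont_on B (prodf phi) by apply: cont_on_prodf => i; exact: spline2_cont.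
have cc : cont_on B (caputo (l k) g (prodf phi) k) by have [] := caputo_prodf_C1 k g01.
rewrite (mint_innermost ks (cont_onM cG cc) Bp) (mint_innermost ks (cont_onM cV cphi) Bp).
apply: mint_eq => // {Bp}p Bp.
pose c := prodf' phi k p.
rewrite /Lint_at.
transitivity (Lint (Defs.cc (l k) (h k)) (fun y => G (upd p k y) *
    ((Gamma (1 - g))^-1 * Lint (Defs.cc (l k) y) (fun x => (y - x) `^ (- g) *
      (2 * spline (2 - 1) (q k) x * c))))).
  apply: Lint_eq => y yc; rewrite caputo_prodf ?upd_same ?prodf'_upd//.
  exact: box_upd.
transitivity (Lint (Defs.cc (l k) (h k)) (fun y => V (upd p k y) * (phi k y * c))); last first.
  by apply: Lint_eq => y yc; rewrite prodf_upd.
apply: (@fractional_parts R g g01 (l k) (h k) (fun y => G (upd p k y))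
  (fun y => phi k y * c) (fun x => 2 * spline (2 - 1) (q k) x * c)
  (fun y => V (upd p k y))).
- exact/ltW/lh.
- exact: cont_on_slice cG Bp.
- exact: cont_on_slice cV Bp.
- have := @primitiveM R (l k) (h k) (phi k) (fun x => 2 * spline (2 - 1) (q k) x)
    (fun=> c) (fun=> 0).
  move=> /(_ _ (primitive_cst _ _ _)) H.
  apply: primitive_eq (H _); first by move=> t _; rewrite mulr0 addr0.
  split; first exact/within_cc_cont/spline2_cont.
  by move=> t _; exact: spline2_derive.
- apply: within_ccM; last exact: within_cc_cst.
  exact/within_cc_cont/spline2_derive_cont.
- by rewrite phil mul0r.
- by rewrite phih mul0r.
(* Restricts the derivative taken within the box to the line through p, where nested updates of
   coordinate [k] collapse into one. *)
move=> t tc; have := hRL _ (box_upd Bp tc).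
rewrite /is_RLright /pderiv_within upd_same => H.
have /deriv_withinS : Defs.cc (l k) (h k) `<=` [set s | B (upd (upd p k t) k s)].
  by move=> x xc; rewrite /= updd; exact: box_upd.
move=> /(_ _ _ _ H); congr deriv_within; apply/funext => x.
rewrite updd upd_same; apply: Lint_eq => y _.
by rewrite updd.
Qed.

End ProductTestFunctions.

Lemma test_funP (R : realType) (c d : R) phi : test_fun c d phi ->
  exists q, [/\ phi = spline 2 q, forall x, x \in q -> c <= x.2, phi c = 0 & phi d = 0].
Proof.
move=> [c0 [w [w0 h1 h2 ->]]]; exists (bspline c0 w); split => //.
- by move=> x; rewrite !inE => /or4P[]/eqP-> /=; lra.
- by rewrite bspline_left.
- by have [_] := bspline2 c0 d w0; apply.
Qed.

Lemma test_fun_exists (R : realType) (c d : R) : c < d -> exists phi, test_fun c d phi.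
Proof.
move=> cd; exists (spline 2 (bspline c ((d - c) / 3))), c, ((d - c) / 3).
split => //; first by rewrite divr_gt0// subr_gt0.
by rewrite mulrC divfK// addrC subrK.
Qed.

Lemma mvt_abs (R : realType) (F f : R -> R) (x y v e : R) :
  (forall t, is_derive t (1 : R) F (f t)) ->
  (forall t, `|t - x| <= `|y - x| -> `|f t - v| <= e) ->
  `|F y - F x - (y - x) * v| <= e * `|y - x|.
Proof.
move=> dF hf.
have prim c d : primitive_on c d F f.
  split=> [|t _]; last exact: dF.
  apply: within_cc_cont => t; apply: differentiable_continuous.
  by apply/derivable1_diffP; have [] := dF t.
have [xy|yx] := leP x y.
  rewrite [`|y - x|]ger0_norm ?subr_ge0//; apply: (primitive_mvt (prim x y) xy).
  move=> t /andP[? ?]; apply: hf; rewrite !ger0_norm; lra.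
have := @primitive_mvt R y x F f v e (prim y x) (ltW yx).
rewrite [`|y - x|]ltr0_norm ?subr_lt0// opprB -normrN.
rewrite (_ : - (F x - F y - (x - y) * v) = F y - F x - (y - x) * v); last by ring.
apply; move=> t /andP[? ?]; apply: hf.
by rewrite ltr0_norm ?subr_lt0// ltr0_norm ?subr_lt0//; lra.
Qed.

Lemma common_pos (R : realType) (J : finType) (P : J -> R -> Prop) :
  (forall j d d', d' <= d -> P j d -> P j d') ->
  (forall j, exists d, 0 < d /\ P j d) -> exists d, 0 < d /\ forall j, P j d.
Proof.
move=> mono /choice[d hd].
exists (\big[Num.min/1]_j d j); split.
  by elim/big_ind: _ => [|x y|j _]; [|move=> x0 y0; rewrite lt_min x0|have [] := hd j].
move=> j; have [_] := hd j; apply: mono.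
by rewrite (bigD1 j)//= ge_min lexx.
Qed.

(** * Linearization of the Lagrangian in its unconstrained arguments *)

Section PartialC1.
Variables (R : realType) (K J : finType) (l h : K -> R).
Implicit Types (p : K -> R) (w v : J -> R).

Definition join p w : K + J -> R :=
  fun x => match x with inl k => p k | inr j => w j end.

Variable L : (K -> R) -> (J -> R) -> R.
Let S := [set q : K + J -> R | box l h (fun k => q (inl k))].
Let F := fun q : K + J -> R => L (fun k => q (inl k)) (fun j => q (inr j)).
Hypothesis LC1 : C1on S F.

Let D j (q : K + J -> R) := pd (L (fun k => q (inl k))) j (fun i => q (inr i)).

(** The set [S] does not restrict the coordinates in [J], so each of its points is interior in these
    directions and the derivative within [S] is the ordinary [pd]. *)
Lemma partial_is_derive j p w : box l h p ->
  is_derive (w j) (1 : R) (fun s => L p (upd w j s)) (pd (L p) j w).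
Proof.
move=> Bp; have [_ /(_ (inr j))[Dj [hD _]]] := LC1.
have Sjoin : S (join p w) by [].
have H : is_derive (w j) (1 : R) (fun s => L p (upd w j s)) (Dj (join p w)).
  have : is_derive (join p w (inr j)) (1 : R)
      (fun s => F (upd (join p w) (inr j) s)) (Dj (join p w)).
    apply: pderiv_within_is_derive (hD _ Sjoin); exists 1; split => // s _.
  by [].
by rewrite /pd (is_derive_derive1 H).
Qed.

Lemma partial_cont j : cont_on S (D j).
Proof.
have [_ /(_ (inr j))[Dj [hD cD]]] := LC1.
apply: cont_on_eq cD => q Sq.
apply/esym; rewrite /D /pd; apply: is_derive_derive1.
have : is_derive (q (inr j)) (1 : R) (fun s => F (upd q (inr j) s)) (Dj q).
  apply: pderiv_within_is_derive (hD _ Sq); exists 1; split => // s _.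
by [].
Qed.

(* Change the coordinates of the second argument one at a time. *)
Lemma partial_linearization (M e : R) : 0 < e -> exists del, 0 < del /\
  forall p w v, box l h p -> (forall j, `|w j| <= M) -> (forall j, `|v j| < del) ->
  `|L p (fun j => w j + v j) - L p w - \sum_j v j * pd (L p) j w|
     <= e * \sum_j `|v j|.
Proof.
move=> e0.
(* The margin 1 beyond M makes room for w + v with v below 1; on this compact box the partial
   derivatives are uniformly continuous. *)
pose l' (x : K + J) := match x with inl k => l k | inr _ => - (M + 1) end.
pose h' (x : K + J) := match x with inl k => h k | inr _ => M + 1 end.
have S' q : box l' h' q -> S q by move=> Bq k; exact: (Bq (inl k)).
have unif j : exists d, 0 < d /\ forall q q', box l' h' q -> box l' h' q' ->
    (forall x, `|q' x - q x| < d) -> `|D j q' - D j q| < e.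
  apply: cont_on_box_unif => // q Bq eps eps0.
  have [d [d0 hd]] := @partial_cont j q (S' q Bq) eps eps0.
  by exists d; split => // q' Bq'; apply: hd; exact: S'.
have [|d [d0 hd]] := common_pos _ unif.
  move=> j d d' dd H q q' Bq Bq' qq; apply: H => // x.
  exact: lt_le_trans (qq x) dd.
exists (Num.min d 1); split; first by rewrite lt_min d0 ltr01.
move=> p w v Bp wM vd.
(* [ws s] has exactly the coordinates in [s] shifted; [ws (j :: s)] differs from it in coordinate
   [j] alone, so the one-variable mean value inequality applies. *)
pose ws (s : seq J) := fun j => if j \in s then w j + v j else w j.
suff H s : uniq s ->
    `|L p (ws s) - L p w - \sum_(j <- s) v j * pd (L p) j w| <= e * \sum_(j <- s) `|v j|.
  have := H _ (enum_uniq J); rewrite !big_enum /=.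
  by rewrite (_ : ws _ = fun j => w j + v j)//; apply/funext => j; rewrite /ws mem_enum.
elim: s => [_|j s IH /= /andP[js us]].
  rewrite !big_nil mulr0 subr0 (_ : ws [::] = w); last by apply/funext.
  by rewrite subrr normr0.
have box_near (w' : J -> R) : (forall i, `|w' i - w i| < Num.min d 1) ->
    box l' h' (join p w').
  move=> ww' [k|i] /=; first exact: Bp.
  have := ww' i; rewrite lt_min => /andP[_]; have := wM i.
  by rewrite ler_norml ltr_norml; lra.
have m0 : 0 < Num.min d 1 by rewrite lt_min d0 ltr01.
have Bw : box l' h' (join p w) by apply: box_near => i; rewrite subrr normr0.
have step : `|L p (ws (j :: s)) - L p (ws s) - v j * pd (L p) j w| <= e * `|v j|.
  have wsE : ws (j :: s) = upd (ws s) j (w j + v j).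
    apply/funext => i; rewrite /ws /upd inE; case: eqP => [->|//].
    by rewrite /=.
  have wsE' : ws s = upd (ws s) j (w j).
    by apply/funext => i; rewrite /upd; case: eqP => // ->; rewrite /ws (negbTE js).
  have := @mvt_abs R (fun t => L p (upd (ws s) j t)) (fun t => pd (L p) j (upd (ws s) j t))
    (w j) (w j + v j) (pd (L p) j w) e.
  rewrite -wsE -wsE' addrAC subrr add0r; apply.
    move=> t; have := partial_is_derive j (upd (ws s) j t) Bp.
    rewrite upd_same; congr (is_derive _ _ _ _).
    by apply/funext => x; rewrite updd.
  move=> t tw; have near : forall i, `|upd (ws s) j t i - w i| < Num.min d 1.
    move=> i; rewrite /upd; case: eqP => [->|_]; first exact: le_lt_trans tw (vd j).
    rewrite /ws; case: ifP => _; first by rewrite addrAC subrr add0r.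
    by rewrite subrr normr0.
  have := hd j _ _ Bw (box_near _ near); rewrite /D /= => H; apply/ltW/H.
  move=> [k|i] /=; first by rewrite subrr normr0.
  by have := near i; rewrite lt_min => /andP[].
rewrite !big_cons mulrDr.
have -> : L p (ws (j :: s)) - L p w -
    (v j * pd (L p) j w + \sum_(i <- s) v i * pd (L p) i w) =
  (L p (ws (j :: s)) - L p (ws s) - v j * pd (L p) j w) +
  (L p (ws s) - L p w - \sum_(i <- s) v i * pd (L p) i w) by ring.
by apply: le_trans (ler_normD _ _) _; apply: lerD => //; exact: IH.
Qed.

Lemma cont_on_compose (W : (K -> R) -> J -> R) (G : (K + J -> R) -> R) :
  cont_on S G -> (forall j, cont_on (box l h) (fun p => W p j)) ->
  cont_on (box l h) (fun p => G (join p (W p))).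
Proof.
move=> cG cW p Bp e e0.
have [|d [d0 hd]] := cG (join p (W p)) _ e e0; first by [].
have [||d' [d'0 hd']] := @common_pos R J (fun j d' => forall q, box l h q ->
    (forall k, `|q k - p k| < d') -> `|W q j - W p j| < d).
- move=> j d1 d2 d21 H q Bq qp; apply: H => // k; exact: lt_le_trans (qp k) d21.
- by move=> j; have [d' [d'0 hd']] := cW j p Bp d d0; exists d'.
exists (Num.min d d'); split; first by rewrite lt_min d0.
move=> q Bq qp; apply: hd => //.
move=> [k|j] /=; first by have := qp k; rewrite lt_min => /andP[].
by apply: hd' => // k; have := qp k; rewrite lt_min => /andP[].
Qed.

Lemma cont_on_L (W : (K -> R) -> J -> R) :
  (forall j, cont_on (box l h) (fun p => W p j)) ->
  cont_on (box l h) (fun p => L p (W p)).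
Proof. by apply: (cont_on_compose (G := F)); case: LC1. Qed.

Lemma cont_on_pdL (W : (K -> R) -> J -> R) j :
  (forall j, cont_on (box l h) (fun p => W p j)) ->
  cont_on (box l h) (fun p => pd (L p) j (W p)).
Proof. by apply: (cont_on_compose (G := D j)); exact: partial_cont. Qed.

End PartialC1.

(** * Variation of the state equation *)

Section VariationOfODE.
Variables (R : realType) (a b : R).
Hypothesis ab : a < b.
Implicit Types (A B : R -> R).

Lemma primitive_le0 c d (F f : R -> R) : primitive_on c d F f -> c <= d ->
  (forall t, c < t < d -> f t <= 0) -> F d <= F c.
Proof.
move=> [cF dF]; rewrite le_eqVlt => /predU1P[->//|cd] f0.
have dF' x : x \in `]c, d[ -> is_derive x (1 : R) F (f x).
  by rewrite in_itv /= => xc; exact: dF.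
have [t tc E] := MVT cd dF' cF.
rewrite -subr_le0 E; apply: mulr_le0_ge0; last by rewrite subr_ge0 ltW.
by apply: f0; move: tc; rewrite in_itv.
Qed.

(* On an interval where [y] stays below [rho], the function
   exp(-3Mt) (y^2 + e^2) is nonincreasing. *)
Lemma gronwall_square (y y' : R -> R) (M e rho c : R) : 0 < M -> a <= c <= b ->
  primitive_on a b y y' -> y a = 0 ->
  (forall t, a <= t <= b -> `|y t| < rho -> `|y' t| <= M * (`|e| + `|y t|)) ->
  (forall t, a <= t < c -> `|y t| < rho) ->
  y c ^+ 2 <= e ^+ 2 * expR (3 * M * (b - a)).
Proof.
move=> M0 /andP[ac cb] py ya hy' hy.
pose u t := y t * y t + e ^+ 2.
pose E t := expR (- (3 * M) * t).
have pu : primitive_on a c u (fun t => y' t * y t + y t * y' t + 0).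
  have py1 := primitiveS (lexx a) cb py.
  by apply: primitiveD (primitiveM py1 py1) (primitive_cst _ _ _).
have pE : primitive_on a c E (fun t => expR (- (3 * M) * t) * (- (3 * M) * 1)).
  apply: (@primitive_comp R a c (fun t => - (3 * M) * t) (fun t => - (3 * M) * 1) expR expR).
  by apply: (@primitiveZ R a c id (fun=> 1)); exact: primitive_id.
have := primitive_le0 (primitiveM pE pu) ac.
have h : forall t, a < t < c ->
    expR (- (3 * M) * t) * (- (3 * M) * 1) * u t +
    E t * (y' t * y t + y t * y' t + 0) <= 0.
  move=> t /andP[at_ tc]; rewrite /E /u.
  rewrite (_ : _ + _ = expR (- (3 * M) * t) *
    (2 * (y t * y' t) - 3 * M * (y t * y t + e ^+ 2))); last by ring.
  rewrite pmulr_rle0 ?expR_gt0// subr_le0.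
  have yt : `|y t| < rho by apply: hy; rewrite ltW.
  have h1 : `|y' t| <= M * (`|e| + `|y t|).
    by apply: hy' => //; rewrite (ltW at_) (le_trans (ltW tc)).
  have h2 : y t * y' t <= `|y t| * `|y' t| by rewrite -normrM ler_norm.
  have h3 : `|y t| * `|y' t| <= `|y t| * (M * (`|e| + `|y t|)) by rewrite ler_wpM2l.
  have h4 : y t * y t = `|y t| * `|y t| by rewrite -normrM ger0_norm// -expr2 sqr_ge0.
  have h5 : e ^+ 2 = `|e| ^+ 2 by rewrite real_normK ?num_real.
  (* Since 2|e||y| <= e^2 + y^2, the derivative 2 y y' is at most M (e^2 + 3 y^2), whence the
     constant 3. Squares are used because |y| need not be differentiable. *)
  rewrite h4 h5; have : 0 <= M * (`|y t| - `|e|) ^+ 2 by rewrite mulr_ge0 ?sqr_ge0// ltW.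
  by have : 0 <= M * `|e| ^+ 2; [rewrite mulr_ge0 ?sqr_ge0// ltW|nra].
move=> /(_ h); rewrite /u /E ya mulr0 add0r => H.
have H1 : expR (- (3 * M) * c) * y c ^+ 2 <= expR (- (3 * M) * a) * e ^+ 2.
  apply: le_trans H; rewrite ler_pM2l ?expR_gt0// -expr2 lerDl.
  exact: sqr_ge0.
have H2 : y c ^+ 2 <= e ^+ 2 * expR (3 * M * (c - a)).
  rewrite -(ler_pM2l (expR_gt0 (- (3 * M) * c))); apply: le_trans H1 _.
  rewrite [leRHS]mulrCA -expRD [leLHS]mulrC (_ : _ + _ = - (3 * M) * a)//; ring.
apply: le_trans H2 _; rewrite ler_wpM2l ?sqr_ge0// ler_expR.
by rewrite ler_wpM2l ?mulr_ge0 ?(ltW M0)// lerD2r.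
Qed.

(** [c] is the infimum of the times with |y| >= rho; continuity shows that it is one of them. *)
Lemma first_exit (y : R -> R) (rho t0 : R) : {within `[a, b], continuous y} ->
  a <= t0 <= b -> rho <= `|y t0| -> exists c, [/\ a <= c <= b, rho <= `|y c| &
    forall t, a <= t < c -> `|y t| < rho].
Proof.
move=> /within_ccP cy t0ab yt0.
pose Z := [set t | a <= t <= b /\ rho <= `|y t|].
have Zt0 : Z t0 by [].
have hinf : has_inf Z by split; [exists t0|exists a => t [/andP[]]].
pose c := inf Z.
have ac : a <= c by apply: lb_le_inf; [exists t0|move=> t [/andP[]]].
have ct0 : c <= t0 by apply: ge_inf => //; case: hinf.
have cab : a <= c <= b by case/andP: t0ab => ? ?; rewrite ac (le_trans ct0).
exists c; split => //; last first.
  move=> t /andP[at_ tc]; rewrite ltNge; apply/negP => yt.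
  have : Z t by split => //; case/andP: cab => ? ?; rewrite at_ (le_trans (ltW tc)).
  by move=> /(ge_inf hinf.2); rewrite leNgt tc.
rewrite leNgt; apply/negP => yc.
have yc0 : 0 < rho - `|y c| by rewrite subr_gt0.
have [d [d0 hd]] := cy c cab _ yc0.
have [t [tab yt] tc] := inf_adherent d0 hinf.
have ct : c <= t by apply: ge_inf => //; case: hinf.
have := hd t tab; rewrite ger0_norm ?subr_ge0// ltrBlDl => /(_ tc) h1.
have := ler_normD (y t - y c) (y c); rewrite subrK; lra.
Qed.

(** A bootstrap: the growth bound is known only while |y| < rho. At a first exit time Gronwall would
    still give |y| <= X |e| < rho, so there is no exit, and the estimate holds on all of [a, b]. *)
Lemma small_solution (y y' : R -> R -> R) (M rho : R) : 0 < M -> 0 < rho ->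
  (forall e, primitive_on a b (y e) (y' e)) -> (forall e, y e a = 0) ->
  (forall e t, a <= t <= b -> `|e| < rho -> `|y e t| < rho ->
     `|y' e t| <= M * (`|e| + `|y e t|)) ->
  exists C rho', [/\ 0 < C, 0 < rho', rho' <= rho & forall e t, `|e| < rho' ->
    a <= t <= b -> `|y e t| <= C * `|e| /\ `|y e t| < rho].
Proof.
move=> M0 rho0 py ya hy'.
pose X := expR (3 * M * (b - a)).
have X1 : 1 <= X.
  by rewrite -expR0 ler_expR !mulr_ge0 ?(ltW M0)// subr_ge0 ltW.
have X0 : 0 < X by exact: lt_le_trans X1.
have rX : rho / X <= rho by rewrite ler_pdivrMr// ler_peMr// ltW.
exists X, (rho / X); split => //; first exact: divr_gt0.
move=> e t eX tab.
have er : `|e| < rho := lt_le_trans eX rX.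
(* The square root of X is replaced by X itself, as X >= 1. *)
have e2 c : y e c ^+ 2 <= e ^+ 2 * X -> `|y e c| <= X * `|e|.
  move=> h; rewrite -(@ler_pXn2r _ 2)// ?nnegrE ?mulr_ge0 ?(ltW X0)//.
  rewrite real_normK ?num_real// exprMn real_normK ?num_real//.
  apply: le_trans h _; rewrite mulrC ler_wpM2r ?sqr_ge0//.
  by rewrite expr2 ler_peMr// ltW.
have eX' : X * `|e| < rho by rewrite mulrC -ltr_pdivlMr.
have small s : a <= s <= b -> `|y e s| < rho.
  move=> sab; rewrite ltNge; apply/negP => ys.
  have [c [cab yc hc]] := first_exit (py e).1 sab ys.
  have := gronwall_square M0 cab (py e) (ya e) (fun t tab => hy' e t tab er) hc.
  by move=> /e2; lra.
split; last exact: small.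
apply: e2; apply: (gronwall_square M0 tab (py e) (ya e) (rho := rho)).
  by move=> s sab; exact: hy'.
move=> s /andP[as_ st]; apply: small; rewrite as_ /=.
by case/andP: tab => _; exact: le_trans (ltW st).
Qed.

(** [lam] is an integrating factor, with derivative - lam B. In the derivative of lam y - e int lam
    A the term with B cancels, and what is left is lam times the remainder, which is o(e) thanks to
    |y| <= C |e|. *)
Lemma ode_variation (y y' : R -> R -> R) A B (lam := fun t => expR (- Lint (cc a t) B)) :
  {within `[a, b], continuous A} -> {within `[a, b], continuous B} ->
  (forall e, primitive_on a b (y e) (y' e)) -> (forall e, y e a = 0) ->
  (forall eps, 0 < eps -> exists rho, 0 < rho /\ forall e t, a <= t <= b ->
     `|e| < rho -> `|y e t| < rho ->
     `|y' e t - (e * A t + B t * y e t)| <= eps * (`|e| + `|y e t|)) ->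
  forall eps, 0 < eps -> exists rho, 0 < rho /\ forall e, `|e| < rho ->
    `|lam b * y e b - e * Lint (cc a b) (fun t => lam t * A t)| <= eps * `|e|.
Proof.
move=> cA cB py ya lin eps eps0.
have [MA [MA0 hA]] := within_cc_bounded cA.
have [MB [MB0 hB]] := within_cc_bounded cB.
have [r1 [r10 lin1]] := lin 1 ltr01.
have M0 : 0 < MA + MB + 1 by rewrite !addr_gt0.
have hy' e t : a <= t <= b -> `|e| < r1 -> `|y e t| < r1 ->
    `|y' e t| <= (MA + MB + 1) * (`|e| + `|y e t|).
  move=> tab er yr; have h := lin1 e t tab er yr.
  rewrite (_ : y' e t = (y' e t - (e * A t + B t * y e t)) +
    (e * A t + B t * y e t)); last by ring.
  apply: le_trans (ler_normD _ _) _.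
  have h1 : `|e * A t + B t * y e t| <= `|e| * MA + MB * `|y e t|.
    apply: le_trans (ler_normD _ _) _; rewrite !normrM; apply: lerD.
      by rewrite ler_wpM2l ?hA.
    by rewrite ler_wpM2r ?hB.
  have h2 : 0 <= MA * `|y e t| by rewrite mulr_ge0 ?(ltW MA0).
  have h3 : 0 <= MB * `|e| by rewrite mulr_ge0 ?(ltW MB0).
  by nra.
have [C [r2 [C0 r20 r21 hC]]] := small_solution M0 r10 py ya hy'.
have pint := Lint_primitive (ltW ab) cB.
have plam : primitive_on a b lam (fun t => lam t * (- B t)).
  apply: (@primitive_comp R a b (fun t => - Lint (cc a t) B) (fun t => - B t) expR expR).
  exact: primitiveN.
have clam := plam.1.
have clA := within_ccM clam cA.
have plA := Lint_primitive (ltW ab) clA.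
have [Ml [Ml0 hl]] := within_cc_bounded clam.
(* The bound [Ml] of lam, the factor in |e| + |y| <= (1 + C)|e| and the length b - a make up the
   total constant; the [+ 1] makes it a positive divisor. *)
pose N := Ml * (1 + C) * (b - a) + 1.
have N0 : 0 < N.
  by rewrite ltr_wpDl// !mulr_ge0 ?subr_ge0 ?(ltW Ml0) ?(ltW ab)// addr_ge0 ?(ltW C0).
have [r3 [r30 lin3]] := lin (eps / N) (divr_gt0 eps0 N0).
have C1 : 0 < C + 1 by rewrite addr_gt0.
(* The second bound puts both |e| and |y| <= C |e| below [r3]. *)
exists (Num.min r2 (r3 / (C + 1))); split; first by rewrite lt_min r20 divr_gt0.
move=> e; rewrite lt_min => /andP[er2 er3].
have er3' : (C + 1) * `|e| < r3 by rewrite mulrC -ltr_pdivlMr.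
pose X t := lam t * y e t - e * Lint (cc a t) (fun t => lam t * A t).
have pX : primitive_on a b X (fun t => lam t * (- B t) * y e t + lam t * y' e t -
    e * (lam t * A t)).
  by apply: primitiveB; [exact: primitiveM|exact: primitiveZ].
have Xa : X a = 0 by rewrite /X ya Lint_cc1 !mulr0 subrr.
have := @primitive_mvt R a b X _ 0 (Ml * (eps / N * (`|e| + C * `|e|))) pX (ltW ab).
rewrite Xa mulr0 !subr0 => H; apply: le_trans (H _) _.
  move=> t /andP[at_ tb]; have tab : a <= t <= b by rewrite !ltW.
  have [yC _] := hC e t er2 tab.
  rewrite subr0 (_ : _ - _ = lam t * (y' e t - (e * A t + B t * y e t))); last by ring.
  rewrite normrM; apply: ler_pM => //; first exact: hl.
  apply: le_trans (lin3 e t tab _ _) _.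
  - have : 0 <= C * `|e| by rewrite mulr_ge0 ?(ltW C0).
    lra.
  - have : 0 <= `|e| by [].
    lra.
  by rewrite ler_wpM2l ?lerD2l// ltW// divr_gt0.
have E (Ni : R) : Ml * (eps * Ni * (`|e| + C * `|e|)) * (b - a) =
    eps * `|e| * (Ml * (1 + C) * (b - a) * Ni) by ring.
rewrite E.
rewrite ler_piMr ?mulr_ge0 ?(ltW eps0)// ler_pdivrMr// mul1r /N.
by rewrite lerDl.
Qed.

End VariationOfODE.

Section BoxSlices.
Variables (R : realType) (I : finType) (l h : I -> R).
Implicit Types (G : (I -> R) -> R) (p q : I -> R) (k : I) (s : seq I).
Local Notation B := (box l h).

(** The bound is required only on the slice through [p]. At fixed time it may thus depend on t, as
    it does through [y e t] in [state_linearization]. *)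
Lemma mint_bound_slice s G (M : R) p : cont_on B G -> B p ->
  (forall q, B q -> (forall k, k \notin s -> q k = p k) -> `|G q| <= M) ->
  `|mint l h s G p| <= M * \prod_(k <- s) (h k - l k).
Proof.
move=> cG; elim: s p => [|k s IH] p Bp hM.
  by rewrite big_nil mulr1 hM.
rewrite big_cons (mulrC (h k - l k)) mulrA; apply: Lint_bound.
- exact: box_le Bp.
- exact: cont_on_slice (mint_cont s cG) Bp.
move=> y yc; apply: IH; first exact: box_upd.
move=> q Bq qp; apply: hM => // i; rewrite inE negb_or => /andP[ik is_].
by rewrite qp// upd_neq.
Qed.

Lemma cont_on_coord_within k (f : R -> R) : {within `[l k, h k], continuous f} ->
  cont_on B (fun p => f (p k)).
Proof.
move=> /within_ccP cf p Bp e e0; have [d [d0 hd]] := cf (p k) (Bp k) e e0.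
by exists d; split => // q Bq qp; apply: hd.
Qed.

(** Carries the continuity assumed for some version of the fractional derivative over to the given
    values [Vt] and [Vx]. The common factor cancels because Gamma is not 0. *)
Lemma RLright_uniq g G k p (v v' : R) : 0 < g < 1 -> l k < h k -> B p ->
  is_RLright B (h k) g G k p v -> is_RLright B (h k) g G k p v' -> v = v'.
Proof.
move=> g01 lhk Bp H H'.
have sub : cc (l k) (h k) `<=` [set s | B (upd p k s)].
  by move=> x xc; exact: box_upd.
have := deriv_within_uniq lhk (Bp k) (deriv_withinS sub H) (deriv_withinS sub H').
by move/mulfI; apply; rewrite oppr_eq0 gt_eqF// Gamma_gt0.
Qed.

End BoxSlices.

Section BoundFin.
Variables (R : realType) (I J : finType) (l h : I -> R).

Lemma cont_on_fin_bounded (W : (I -> R) -> J -> R) :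
  (forall j, cont_on (box l h) (fun p => W p j)) ->
  exists M, 0 < M /\ forall p j, box l h p -> `|W p j| <= M.
Proof.
move=> cW; have [M hM] := choice (fun j => cont_on_box_bounded (cW j)).
exists (\sum_j M j + 1); split.
  by rewrite ltr_wpDl// sumr_ge0// => j _; rewrite ltW//; case: (hM j).
move=> p j Bp; have [_ h1] := hM j; apply: le_trans (h1 p Bp) _.
rewrite (bigD1 j)//= -addrA lerDl addr_ge0// sumr_ge0// => i _.
by rewrite ltW//; case: (hM i).
Qed.

End BoundFin.

(** * The first variation *)

Section VariationOnBox.
Variables (R : realType) (n m : nat) (a b : R) (aa bb : 'I_n -> R)
  (alpha : 'I_m -> R) (beta : 'I_n -> 'I_m -> R).
Hypotheses (ab : a < b) (aabb : forall i, aa i < bb i)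
  (alpha01 : forall j, 0 < alpha j < 1) (beta01 : forall i j, 0 < beta i j < 1).

Let l : pcoord n -> R := lo a aa.
Let h : pcoord n -> R := hi b bb.
Let P := Pset a b aa bb.
Let xs : seq (pcoord n) := map Some (enum 'I_n).

Lemma lo_lt_hi k : lo a aa k < hi b bb k.
Proof. by case: k => /=. Qed.

Let lP : P l.
Proof. by move=> k; rewrite lexx ltW// lo_lt_hi. Qed.

Lemma iint_mint (s : seq 'I_n) G p : iint aa bb s G p = mint l h (map Some s) G p.
Proof. by elim: s p => //= i s IH p; apply: Lint_eq => y _; exact: IH. Qed.

Lemma notin_xs (k : pcoord n) : k \notin xs -> k = None.
Proof.
by case: k => // i; rewrite mem_map ?mem_enum// => x y [].
Qed.

Lemma None_notin_xs : None \notin xs.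
Proof. by apply/mapP => -[]. Qed.

(** [intOmega] starts from spatial coordinates 0, which may lie outside Omega. They are overwritten,
    so the base point can be moved into P, as the lemmas on [mint] require. *)
Lemma intOmega_mint G t : intOmega aa bb G t = mint l h xs G (upd l None t).
Proof.
by rewrite /intOmega iint_mint; apply: mint_indep => k /notin_xs ->.
Qed.

Let Pt t : a <= t <= b -> P (upd l None t).
Proof. by move=> tab; apply: (box_upd lP). Qed.

Lemma intOmega_cont G : cont_on P G -> {within `[a, b], continuous (intOmega aa bb G)}.
Proof.
move=> cG; apply: (within_cc_eq (f := fun t => mint l h xs G (upd l None t))).
  by move=> t _; rewrite intOmega_mint.
exact: (cont_on_slice (k := None) (mint_cont xs cG) lP).
Qed.

(** Merges time and space into one iterated integral over P; a factor of t alone passes through the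
    inner integrals. All coordinates are integrated, so [l] is just a convenient base point in P. *)
Lemma Lint_intOmega (f : R -> R) G : cont_on P G ->
  Lint (cc a b) (fun t => f t * intOmega aa bb G t) =
  mint l h (None :: xs) (fun q => f (q None) * G q) l.
Proof.
move=> cG; apply: Lint_eq => t tab.
have := mint_pull f None_notin_xs cG (Pt tab).
by rewrite upd_same intOmega_mint => <-.
Qed.

Lemma args_cont v z : regular a b aa bb alpha beta v ->
  {within `[a, b], continuous z} ->
  forall w, cont_on P (fun p => args a aa alpha beta v z p w).
Proof.
move=> rv cz [[[j|j]|[i j]]|[]] /=.
- by have [[]] := rv j.
- by have [_ [[]]] := rv j.
- by have [_ [_ /(_ i)[]]] := rv j.
- exact: (@cont_on_coord_within _ _ l h None).
Qed.

Lemma regular_lin u v (e : R) : regular a b aa bb alpha beta u ->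
  regular a b aa bb alpha beta v ->
  regular a b aa bb alpha beta (fun j p => u j p + e * v j p).
Proof.
move=> ru rv j; have [u1 [u2 u3]] := ru j; have [v1 [v2 v3]] := rv j.
split; first exact: C1on_lin.
split.
  apply: C1on_eq (C1on_lin e u2 v2) => p Pp; apply/esym.
  exact: (@caputo_lin _ _ l h _ (alpha01 j) _ _ e None p u1 v1 Pp).
move=> i; apply: C1on_eq (C1on_lin e (u3 i) (v3 i)) => p Pp; apply/esym.
exact: (@caputo_lin _ _ l h _ (beta01 i j) _ _ e (Some i) p u1 v1 Pp).
Qed.

Lemma admissible_lin g u v (e : R) : admissible a b aa bb alpha beta g u ->
  admissible_variation a b aa bb alpha beta v ->
  admissible a b aa bb alpha beta g (fun j p => u j p + e * v j p).
Proof.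
move=> [ru ug] [rv v0]; split; first exact: regular_lin.
by move=> j p bp; rewrite v0// mulr0 addr0 ug.
Qed.

(** The tuple of [v] is taken with state 0, so that the slot of [z] moves by the whole difference of
    the two states, which is not linear in e. *)
Lemma args_lin u v z z' (e : R) p w : regular a b aa bb alpha beta u ->
  regular a b aa bb alpha beta v -> P p ->
  args a aa alpha beta (fun j p => u j p + e * v j p) z' p w =
  args a aa alpha beta u z p w +
  (e * args a aa alpha beta v (fun=> 0) p w +
   if w is inr _ then z' (p None) - z (p None) else 0).
Proof.
move=> ru rv Pp; case: w => [[[j|j]|[i j]]|[]] /=.
- by rewrite addr0.
- have [u1 _] := ru j; have [v1 _] := rv j; rewrite addr0.
  exact: (@caputo_lin _ _ l h _ (alpha01 j) _ _ e None p u1 v1 Pp).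
- have [u1 _] := ru j; have [v1 _] := rv j; rewrite addr0.
  exact: (@caputo_lin _ _ l h _ (beta01 i j) _ _ e (Some i) p u1 v1 Pp).
- by ring.
Qed.

Variables (za : R) (g : (pcoord n -> R) -> 'I_m -> R)
  (L : (pcoord n -> R) -> (widx n m -> R) -> R)
  (zf : ('I_m -> (pcoord n -> R) -> R) -> R -> R)
  (u : 'I_m -> (pcoord n -> R) -> R).
Hypothesis LC1 : C1on [set q : (pcoord n + widx n m)%type -> R |
          Pset a b aa bb (fun k => q (inl k))]
       (fun q => L (fun k => q (inl k)) (fun w => q (inr w))).
Hypothesis zfE : forall v, admissible a b aa bb alpha beta g v ->
     zf v a = za /\
     forall t, a <= t <= b ->
       deriv_within (cc a b) (zf v) t
         (intOmega aa bb (fun p => L p (args a aa alpha beta v (zf v) p)) t).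
Hypothesis uadm : admissible a b aa bb alpha beta g u.

Let W := args a aa alpha beta u (zf u).
Let lam t : R := expR (- Lint (cc a t)
  (fun tau => intOmega aa bb (fun p => pd (L p) (Wz n m) (W p)) tau)).

Let zf_prim v : admissible a b aa bb alpha beta g v ->
  primitive_on a b (zf v)
    (intOmega aa bb (fun p => L p (args a aa alpha beta v (zf v) p))).
Proof. by move=> /zfE[_ hd]; exact: deriv_within_primitive. Qed.

Let Wcont w : cont_on P (fun p => W p w).
Proof. by apply: args_cont; [case: uadm|case: (zf_prim uadm)]. Qed.

Lemma pdL_cont w : cont_on P (fun p => pd (L p) w (W p)).
Proof. exact: (@cont_on_pdL _ _ _ l h L LC1 W w Wcont). Qed.

Lemma multiplier_cont : {within `[a, b], continuous lam}.
Proof.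
have cB := intOmega_cont (pdL_cont (Wz n m)).
have pB := Lint_primitive (ltW ab) cB.
have [] := @primitive_comp R a b _ _ expR expR (primitiveN pB) (fun x => is_derive_expR x).
by [].
Qed.

Section Direction.
Variable eta : 'I_m -> (pcoord n -> R) -> R.
Hypothesis etaV : admissible_variation a b aa bb alpha beta eta.

Let ue (e : R) : 'I_m -> (pcoord n -> R) -> R := fun j p => u j p + e * eta j p.
Let H := args a aa alpha beta eta (fun=> 0).
Let y e t := zf (ue e) t - zf u t.
Let y' e t := intOmega aa bb (fun p => L p (args a aa alpha beta (ue e) (zf (ue e)) p)) t -
  intOmega aa bb (fun p => L p (W p)) t.
Let A t := intOmega aa bb (fun p => \sum_w H p w * pd (L p) w (W p)) t.
Let B t := intOmega aa bb (fun p => pd (L p) (Wz n m) (W p)) t.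

Let ueadm e : admissible a b aa bb alpha beta g (ue e).
Proof. exact: admissible_lin. Qed.

Let Hcont w : cont_on P (fun p => H p w).
Proof. by apply: args_cont; [case: etaV|exact: within_cc_cst]. Qed.

Let y_prim e : primitive_on a b (y e) (y' e).
Proof. by apply: primitiveB; exact: zf_prim. Qed.

Let sum_cont : cont_on P (fun p => \sum_w H p w * pd (L p) w (W p)).
Proof.
apply: cont_on_sum => w _; apply: cont_onM; first exact: Hcont.
exact: pdL_cont.
Qed.

Let linear_part_cont w e :
  cont_on P (fun p => (e * H p w + if w is inr _ then y e (p None) else 0) * pd (L p) w (W p)).
Proof.
apply: cont_onM; last exact: pdL_cont.
apply: cont_onD; first by apply: cont_onM; [exact: cont_on_cst|exact: Hcont].
case: w => [w|[]]; first exact: cont_on_cst.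
exact: (@cont_on_coord_within _ _ l h None (y e) (y_prim e).1).
Qed.

(** At fixed t the argument tuple moves by [v], each component of which is at most MH |e| + |y e t|.
    The linearization of L thus holds uniformly over the slice and can be integrated; its linear
    part sorts into e A and B y. *)
Lemma state_linearization (eps : R) : 0 < eps -> exists rho, 0 < rho /\
  forall e t, a <= t <= b -> `|e| < rho -> `|y e t| < rho ->
     `|y' e t - (e * A t + B t * y e t)| <= eps * (`|e| + `|y e t|).
Proof.
move=> eps0.
have [MW [MW0 hW]] := cont_on_fin_bounded Wcont.
have [MH [MH0 hH]] := cont_on_fin_bounded Hcont.
pose vol := \prod_(k <- xs) (h k - l k).
have vol0 : 0 <= vol by apply: prodr_ge0 => k _; rewrite subr_ge0 ltW// lo_lt_hi.
pose N := \sum_(w : widx n m) MH.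
have N0 : 0 <= N by apply: sumr_ge0 => w _; exact: ltW.
(* N |e| + |y| bounds the sum of the components of [v], and [vol] is the volume of Omega; Q
   dominates the resulting constant and is positive. *)
pose Q := (N + 1) * vol + 1.
have Q0 : 0 < Q by rewrite ltr_wpDl// mulr_ge0// addr_ge0.
have [del [del0 hdel]] := @partial_linearization _ _ _ l h L LC1 MW (eps / Q) (divr_gt0 eps0 Q0).
have MH1 : 0 < MH + 1 by rewrite addr_gt0.
exists (del / (MH + 1)); split; first exact: divr_gt0.
move=> e t tab er yr.
have ye_small : MH * `|e| + `|y e t| < del.
  rewrite (_ : del = MH * (del / (MH + 1)) + del / (MH + 1)); last first.
    by rewrite -[X in _ + X]mul1r -mulrDl mulrC divfK// gt_eqF.
  by rewrite ltrD// ltr_pM2l.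
pose v (p : pcoord n -> R) (w : widx n m) : R :=
  e * H p w + if w is inr _ then y e (p None) else 0.
have argsE p w : P p -> args a aa alpha beta (ue e) (zf (ue e)) p w = W p w + v p w.
  by move=> Pp; apply: args_lin => //; [case: uadm|case: etaV].
pose D p := L p (fun w => W p w + v p w) - L p (W p) - \sum_w v p w * pd (L p) w (W p).
have vbound q w : P q -> (forall k, k \notin xs -> q k = upd l None t k) ->
    `|v q w| <= MH * `|e| + (if w is inr _ then `|y e t| else 0).
  move=> Pq qt; rewrite /v; apply: le_trans (ler_normD _ _) _; apply: lerD.
    by rewrite normrM mulrC ler_wpM2r// hH.
  case: w => [w|[]]; first by rewrite normr0.
  by rewrite qt ?None_notin_xs// upd_same.
have cLe : cont_on P (fun p => L p (args a aa alpha beta (ue e) (zf (ue e)) p)).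
  apply: (@cont_on_L _ _ _ l h L LC1) => w.
  by apply: args_cont; [case: (ueadm e)|case: (zf_prim (ueadm e))].
have cLu : cont_on P (fun p => L p (W p)) by exact: (@cont_on_L _ _ _ l h L LC1 W Wcont).
have cS : cont_on P (fun p => \sum_w v p w * pd (L p) w (W p)).
  by apply: cont_on_sum => w _; exact: linear_part_cont.
have DE p : P p -> L p (args a aa alpha beta (ue e) (zf (ue e)) p) +
    (-1 * L p (W p) + -1 * \sum_w v p w * pd (L p) w (W p)) = D p.
  move=> Pp; rewrite /D (_ : args a aa alpha beta (ue e) (zf (ue e)) p = fun w => W p w + v p w).
    by ring.
  by apply/funext => w; exact: argsE.
have cLu' : cont_on P (fun p => -1 * L p (W p)) by apply: cont_onM => //; exact: cont_on_cst.
have cS' : cont_on P (fun p => -1 * \sum_w v p w * pd (L p) w (W p)).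
  by apply: cont_onM => //; exact: cont_on_cst.
have cD : cont_on P D by apply: cont_on_eq DE _; apply: cont_onD => //; exact: cont_onD.
have sumE p : \sum_w v p w * pd (L p) w (W p) =
    e * (\sum_w H p w * pd (L p) w (W p)) + y e (p None) * pd (L p) (Wz n m) (W p).
  rewrite mulr_sumr (bigD1 (Wz n m))//= [in RHS](bigD1 (Wz n m))//= /v /=.
  rewrite [X in _ + X = _](eq_bigr (fun w => e * (H p w * pd (L p) w (W p)))).
    by ring.
  by case=> [w|[]]//= _; rewrite addr0 mulrA.
have ID : mint l h xs D (upd l None t) = y' e t - (e * A t + B t * y e t).
  have Pl := Pt tab.
  rewrite -(mint_eq xs DE Pl).
  rewrite (mintD xs cLe (cont_onD cLu' cS') Pl) (mintD xs cLu' cS' Pl).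
  rewrite (mintZ xs (-1) cLu Pl) (mintZ xs (-1) cS Pl).
  rewrite (mint_eq xs (fun p _ => sumE p) Pl).
  have c1 : cont_on P (fun p => e * (\sum_w H p w * pd (L p) w (W p))).
    by apply: cont_onM => //; exact: cont_on_cst.
  have c2 : cont_on P (fun p => y e (p None) * pd (L p) (Wz n m) (W p)).
    apply: cont_onM; last exact: pdL_cont.
    exact: (@cont_on_coord_within _ _ l h None (y e) (y_prim e).1).
  rewrite (mintD xs c1 c2 Pl) (mintZ xs e sum_cont Pl).
  rewrite (mint_pull (y e) None_notin_xs (pdL_cont (Wz n m)) Pl) upd_same.
  by rewrite /y' /A /B !intOmega_mint; ring.
rewrite -ID.
have -> : eps * (`|e| + `|y e t|) = (eps / Q) * (`|e| + `|y e t|) * Q.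
  by rewrite mulrAC divfK// gt_eqF.
apply: le_trans (mint_bound_slice (M := eps / Q * (N * `|e| + `|y e t|)) cD (Pt tab) _) _.
  move=> q Pq qt; rewrite /D.
  apply: le_trans (hdel q (W q) (v q) Pq (fun w => hW q w Pq) _) _.
    move=> w; apply: le_lt_trans (vbound q w Pq qt) _.
    case: w => [w|w]; last exact: ye_small.
    by rewrite addr0; apply: le_lt_trans ye_small; rewrite lerDl.
  apply: ler_wpM2l; first by rewrite ltW// divr_gt0.
  apply: le_trans (ler_sum _ (fun w _ => vbound q w Pq qt)) _.
  rewrite big_split /= -mulr_suml lerD2l.
  rewrite (bigD1 (Wz n m))//= big1 ?addr0//.
  by case=> [w|[]].
rewrite -/vol -[leLHS]mulrA -[leRHS]mulrA ler_pM2l ?divr_gt0//.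
have e'0 : 0 <= `|e| by []. have y0 : 0 <= `|y e t| by [].
apply: (@le_trans _ _ ((`|e| + `|y e t|) * ((N + 1) * vol))).
  rewrite mulrA ler_wpM2r//.
  have : 0 <= N * `|y e t| by rewrite mulr_ge0.
  lra.
by rewrite ler_wpM2l ?addr_ge0// /Q lerDl.
Qed.

(** Extremality says that y(b) = o(e), while [ode_variation] gives lam(b) y(b) = e X + o(e) with X
    the integral in question. Hence X = 0. *)
Lemma first_variation :
  (forall t, a <= t <= b ->
     derivable (fun e : R => zf (fun j p => u j p + e * eta j p) t) 0 1) ->
  derive1 (fun e : R => zf (fun j p => u j p + e * eta j p) b) 0 = 0 ->
  mint l h (None :: xs)
    (fun p => lam (p None) * \sum_w H p w * pd (L p) w (W p)) l = 0.
Proof.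
move=> dz dz0; rewrite -Lint_intOmega//.
have cA : {within `[a, b], continuous A} by exact: intOmega_cont.
have cB : {within `[a, b], continuous B} by exact/intOmega_cont/pdL_cont.
have ya e : y e a = 0.
  by rewrite /y; have [-> _] := zfE (ueadm e); have [-> _] := zfE uadm; rewrite subrr.
have ov := ode_variation ab cA cB y_prim ya state_linearization.
set X := Lint _ _; have XE : X = Lint (cc a b) (fun t => lam t * A t) by [].
have bab : a <= b <= b by rewrite lexx ltW.
have db : is_derive (0 : R) (1 : R) (fun e : R => zf (ue e) b) 0.
  by apply: DeriveDef; [exact: dz|rewrite -derive1E].
have dw := is_derive_deriv_within setT db.
have u0 : ue 0 = u by apply/funext => j; apply/funext => p; rewrite /ue mul0r addr0.
have lb : 0 < lam b + 1 by rewrite addr_gt0// expR_gt0.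
apply/eqP; rewrite -normr_le0 leNgt; apply/negP => X0.
(* Both errors are made at most e (|X|/2)/(lam b + 1); added, with the weight lam b on one of them,
   they give e |X| <= e |X|/2. *)
have e0 : 0 < `|X| / 2 / (lam b + 1) by rewrite !divr_gt0.
have [r1 [r10 h1]] := ov _ e0; have [r2 [r20 h2]] := dw _ e0.
pose e := Num.min r1 r2 / 2.
have m0 : 0 < Num.min r1 r2 by rewrite lt_min r10.
have ep : 0 < e by rewrite divr_gt0.
have : e < Num.min r1 r2 by rewrite /e ltr_pdivrMr// ltr_pMr// ltr1n.
rewrite lt_min => /andP[er1 er2]; clearbody e.
have := h1 e; rewrite gtr0_norm// => /(_ er1); rewrite -/lam -XE => g1.
have := h2 e; rewrite gt_eqF// gtr0_norm// => /(_ isT er2 I).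
rewrite add0r subr0 u0 -/(y e b) normrM normfV (gtr0_norm ep) ltr_pdivrMr// => g2.
have g3 : `|e * X| <= `|lam b * y e b - e * X| + `|lam b * y e b|.
  have tri (p q : R) : `|q| <= `|p - q| + `|p|.
    rewrite addrC -[q in leLHS](subKr p); exact: ler_normB.
  exact: tri.
rewrite !normrM (gtr0_norm ep) (gtr0_norm (expR_gt0 _)) -/(lam b) in g3.
have g4 : lam b * `|y e b| <= lam b * (`|X| / 2 / (lam b + 1) * e).
  by rewrite ler_wpM2l ?expR_ge0// ltW.
have g5 : e * `|X| <= e * (`|X| / 2).
  apply: le_trans g3 _; apply: le_trans (lerD g1 g4) _.
  have E (c : R) : c * e + lam b * (c * e) = e * (c * (lam b + 1)) by ring.
  by rewrite E divfK// gt_eqF.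
by move: g5; rewrite ler_pM2l// => g5; lra.
Qed.

End Direction.

End VariationOnBox.

(** * The Euler-Lagrange equations *)

Theorem theorem3p5 (R : realType) (n m : nat) (a b : R) (aa bb : 'I_n -> R)
  (alpha : 'I_m -> R) (beta : 'I_n -> 'I_m -> R) (za : R)
  (g : (pcoord n -> R) -> 'I_m -> R)
  (L : (pcoord n -> R) -> (widx n m -> R) -> R)
  (zf : ('I_m -> (pcoord n -> R) -> R) -> R -> R)
  (u : 'I_m -> (pcoord n -> R) -> R) :
  a < b ->
  (forall i, aa i < bb i) ->
  (forall j, 0 < alpha j < 1) ->
  (forall i j, 0 < beta i j < 1) ->
  (* L is C^1 on P x R^(m(n+2)+1) *)
  C1on [set q : (pcoord n + widx n m)%type -> R |
          Pset a b aa bb (fun k => q (inl k))]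
       (fun q => L (fun k => q (inl k)) (fun w => q (inr w))) ->
  (* zf v = z[v; .] solves the state equation for every admissible v *)
  (forall v, admissible a b aa bb alpha beta g v ->
     zf v a = za /\
     forall t, a <= t <= b ->
       deriv_within (cc a b) (zf v) t
         (intOmega aa bb (fun p => L p (args a aa alpha beta v (zf v) p)) t)) ->
  admissible a b aa bb alpha beta g u ->
  (* differentiable dependence of z on epsilon *)
  (forall eta, admissible_variation a b aa bb alpha beta eta ->
     forall t, a <= t <= b ->
       derivable (fun e : R => zf (fun j p => u j p + e * eta j p) t) 0 1) ->
  (* extremality: first variation of z[u; b] vanishes *)
  (forall eta, admissible_variation a b aa bb alpha beta eta ->
     derive1 (fun e : R => zf (fun j p => u j p + e * eta j p) b) 0 = 0) ->
  let P := Pset a b aa bb in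
  let W := args a aa alpha beta u (zf u) in
  let lam := fun t : R =>
    expR (- Lint (cc a t)
                 (fun tau => intOmega aa bb (fun p => pd (L p) (Wz n m) (W p)) tau)) in
  (forall j, exists V : (pcoord n -> R) -> R,
     (forall p, P p -> is_RLright P b (alpha j)
        (fun q => lam (q None) * pd (L q) (Wdt n j) (W q)) None p (V p)) /\
     (forall p, P p -> cont_within P V p)) ->
  (forall i j, exists V : (pcoord n -> R) -> R,
     (forall p, P p -> is_RLright P (bb i) (beta i j)
        (fun q => lam (q None) * pd (L q) (Wdx i j) (W q)) (Some i) p (V p)) /\
     (forall p, P p -> cont_within P V p)) ->
  forall (Vt : 'I_m -> (pcoord n -> R) -> R)
         (Vx : 'I_n -> 'I_m -> (pcoord n -> R) -> R),
  (forall j p, P p -> is_RLright P b (alpha j)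
        (fun q => lam (q None) * pd (L q) (Wdt n j) (W q)) None p (Vt j p)) ->
  (forall i j p, P p -> is_RLright P (bb i) (beta i j)
        (fun q => lam (q None) * pd (L q) (Wdx i j) (W q)) (Some i) p (Vx i j p)) ->
  forall j p, P p ->
    lam (p None) * pd (L p) (Wu n j) (W p) + Vt j p + \sum_(i < n) Vx i j p = 0.
Proof.
move=> ab aabb al01 be01 LC1 zfE uadm dz dz0 P W lam exVt exVx Vt Vx hVt hVx j p0 Pp0.
pose l := lo a aa; pose h := hi b bb.
have lh k : l k < h k := @lo_lt_hi R n a b aa bb ab aabb k.
pose xs : seq (pcoord n) := map Some (enum 'I_n).
pose s := None :: xs.
have sall k : k \in s.
  case: k => [i|]; last by rewrite inE eqxx.
  by rewrite inE /= map_f// mem_enum.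
have us : uniq s.
  rewrite /s /= (None_notin_xs n) map_inj_uniq ?enum_uniq//.
have Pl : P l by move=> k; rewrite lexx ltW// lh.
have cpd w : cont_on P (fun q => pd (L q) w (W q)).
  exact: (pdL_cont LC1 zfE uadm w).
have clam : cont_on P (fun q => lam (q None)).
  apply: (@cont_on_coord_within _ _ l h None lam).
  exact: (multiplier_cont ab aabb LC1 zfE uadm).
have clpd w : cont_on P (fun q => lam (q None) * pd (L q) w (W q)) by exact: cont_onM.
have cVt : cont_on P (Vt j).
  have [V [hV cV]] := exVt j; apply: cont_on_eq cV => q Pq.
  exact: (@RLright_uniq _ _ l h (alpha j) _ None q _ _ (al01 j) (lh None) Pq (hV q Pq) (hVt j q Pq)).
have cVx i : cont_on P (Vx i j).
  have [V [hV cV]] := exVx i j; apply: cont_on_eq cV => q Pq.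
  exact: (@RLright_uniq _ _ l h (beta i j) _ (Some i) q _ _ (be01 i j) (lh (Some i)) Pq
    (hV q Pq) (hVx i j q Pq)).
pose G q := lam (q None) * pd (L q) (Wu n j) (W q) + Vt j q + \sum_(i < n) Vx i j q.
have cVs : cont_on P (fun q => \sum_(i < n) Vx i j q) by apply: cont_on_sum => i _.
have cG : cont_on P G by apply: cont_onD => //; apply: cont_onD.
(* [s] contains every coordinate, so the fundamental lemma yields the conclusion at all points of
   P. *)
apply: (@mint_fundamental R _ l h (fun k => test_fun (l k) (h k)) s G l) => //; last 1 first.
- by move=> k; rewrite sall.
- by move=> k phi [c0 [w [w0 _ _ ->]]]; exact: spline_cont.
- by move=> k; exact: test_fun_exists.
- by move=> k f cf hf; exact: test_fun_fundamental.
move=> Phi hPhi.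
have [q hq] := choice (fun k => test_funP (hPhi k)).
have qE k : Phi k = spline 2 (q k) by have [] := hq k.
have ql k x : x \in q k -> l k <= x.2 by have [_ H _ _] := hq k; exact: H.
have phl k : Phi k (l k) = 0 by have [] := hq k.
have phh k : Phi k (h k) = 0 by have [] := hq k.
(* Only the component [j] varies, which isolates the j-th equation. *)
pose eta j' : (pcoord n -> R) -> R := if j' == j then prodf Phi else fun=> 0.
have etaV : admissible_variation a b aa bb alpha beta eta.
  split.
    move=> j'; rewrite /eta; case: eqP => [->|_]; last first.
      split; first exact: C1on_cst.
      split=> [|i].
        rewrite (_ : caputo _ _ _ _ = fun=> 0); first exact: C1on_cst.
        by apply/funext => r; rewrite caputo0.
      rewrite (_ : caputo _ _ _ _ = fun=> 0); first exact: C1on_cst.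
      by apply/funext => r; rewrite caputo0.
    split; first exact: (prodf_C1 l h qE).
    split=> [|i].
      exact: (@caputo_prodf_C1 R _ l h Phi q qE ql (alpha j) None (al01 j)).
    exact: (@caputo_prodf_C1 R _ l h Phi q qE ql (beta i j) (Some i) (be01 i j)).
  move=> j' r [_ [k hk]]; rewrite /eta; case: eqP => // _.
  exact: (prodf_boundary phl phh hk).
have fv := first_variation ab aabb al01 be01 LC1 zfE uadm etaV (dz eta etaV) (dz0 eta etaV).
have cphi : cont_on P (prodf Phi).
  by apply: cont_on_prodf => k; rewrite qE; exact: spline_cont.
have cct : cont_on P (caputo (l None) (alpha j) (prodf Phi) None).
  by have [] := @caputo_prodf_C1 R _ l h Phi q qE ql (alpha j) None (al01 j).
have ccx i : cont_on P (caputo (l (Some i)) (beta i j) (prodf Phi) (Some i)).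
  by have [] := @caputo_prodf_C1 R _ l h Phi q qE ql (beta i j) (Some i) (be01 i j).
pose T0 r := lam (r None) * pd (L r) (Wu n j) (W r) * prodf Phi r.
pose T1 r := lam (r None) * pd (L r) (Wdt n j) (W r) *
  caputo (l None) (alpha j) (prodf Phi) None r.
pose T2 i r := lam (r None) * pd (L r) (Wdx i j) (W r) *
  caputo (l (Some i)) (beta i j) (prodf Phi) (Some i) r.
have c0 : cont_on P T0 := cont_onM (clpd (Wu n j)) cphi.
have c1 : cont_on P T1 := cont_onM (clpd (Wdt n j)) cct.
have c2 i : cont_on P (T2 i) := cont_onM (clpd (Wdx i j)) (ccx i).
have cs2 : cont_on P (fun r => \sum_(i <- enum 'I_n) T2 i r).
  by apply: cont_on_sum => i _; exact: c2.
(* The other components are zero, and so are their Caputo derivatives; the slot of [z] is 0 because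
   the effect of the state is already contained in lam. *)
have sumE r : lam (r None) * (\sum_w args a aa alpha beta eta (fun=> 0) r w * pd (L r) w (W r)) =
    T0 r + T1 r + \sum_(i <- enum 'I_n) T2 i r.
  have eta0 j' : j' != j -> eta j' = fun=> 0 by rewrite /eta => /negbTE ->.
  have etaj : eta j = prodf Phi by rewrite /eta eqxx.
  have pE : \sum_(x : 'I_n * 'I_m) args a aa alpha beta eta (fun=> 0) r (inl (inr x)) *
      pd (L r) (inl (inr x)) (W r) =
      \sum_(i < n) caputo (aa i) (beta i j) (prodf Phi) (Some i) r * pd (L r) (Wdx i j) (W r).
    transitivity (\sum_(i < n) \sum_(j' < m) caputo (aa i) (beta i j') (eta j') (Some i) r *
        pd (L r) (Wdx i j') (W r)).
      by rewrite pair_bigA; apply: eq_bigr => -[i j'].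
    apply: eq_bigr => i _; rewrite (bigD1 j)//= big1 ?addr0 ?etaj//.
    by move=> j' /eta0 ->; rewrite caputo0 mul0r.
  rewrite !big_sumType pE /= big_enum /=.
  rewrite (bigD1 j)//= big1 ?addr0; last by move=> i /eta0 ->; rewrite mul0r.
  rewrite (bigD1 j)//= [X in _ + (_ + X)]big1 ?addr0; last first.
    by move=> i /eta0 ->; rewrite caputo0 mul0r.
  rewrite [X in _ + X](_ : _ = 0) ?addr0; last first.
    by apply: big1 => -[] _; rewrite mul0r.
  rewrite etaj /T0 /T1 /T2 !mulrDr mulr_sumr; congr (_ + _ + _).
  - by rewrite /Wu; ring.
  - by rewrite /Wdt; ring.
  - by apply: eq_bigr => i _; rewrite /Wdx; ring.
(* G times the test function is spread over its terms; [s] lists each coordinate once, so the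
   product along [s] is [prodf Phi]. *)
rewrite (mint_eq s (G' := fun r => lam (r None) * pd (L r) (Wu n j) (W r) * prodf Phi r +
    Vt j r * prodf Phi r + \sum_(i <- enum 'I_n) Vx i j r * prodf Phi r) _ Pl); last first.
  move=> r _; rewrite /G -mulr_suml big_enum /= -!mulrDl; congr (_ * _).
  rewrite /prodf; apply: perm_big; apply: uniq_perm => //; first exact: index_enum_uniq.
  by move=> k; rewrite sall mem_index_enum.
rewrite -[RHS]fv (mint_eq s (fun r _ => sumE r) Pl).
have cVtp : cont_on P (fun r => Vt j r * prodf Phi r) := cont_onM cVt cphi.
have cVxp i : cont_on P (fun r => Vx i j r * prodf Phi r) := cont_onM (cVx i) cphi.
have cVxs : cont_on P (fun r => \sum_(i <- enum 'I_n) Vx i j r * prodf Phi r).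
  by apply: cont_on_sum => i _; exact: cVxp.
rewrite (mintD s (cont_onD c0 cVtp) cVxs Pl) (mintD s c0 cVtp Pl).
rewrite (mintD s (cont_onD c0 c1) cs2 Pl) (mintD s c0 c1 Pl).
rewrite (mint_sum s _ cVxp Pl) (mint_sum s _ c2 Pl).
(* The terms with the derivative in u_j already agree; in each of the others the Caputo derivative
   is moved off the test function. *)
congr (_ + _ + _).
  apply/esym.
  exact: (mint_fractional_parts lh qE ql phl phh (al01 j) (sall None) (clpd _) cVt (hVt j) Pl).
apply: eq_bigr => i _; apply/esym.
exact: (mint_fractional_parts lh qE ql phl phh (be01 i j) (sall (Some i)) (clpd _) (cVx i) (hVx i j) Pl).
Qed.
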